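(* Let $G$ be an undirected connected multigraph with vertex set $[n]$. The sequence $$\mathcal F_0(G):\quad F_{0,n-1}\xrightarrow{\delta_{0,n-1}}\cdots\xrightarrow{\delta_{0,2}}F_{0,1}\xrightarrow{\delta_{0,1}}F_{0,0}=R$$ is a minimal free resolution of the $G$-parking function ideal $M_G$; that is, it is a complex of free $R$-modules, exact in all positive homological degrees (with $0\to F_{0,n-1}$ on the left), the cokernel of $\delta_{0,1}$ is $R/M_G$, and the image of each $\delta_{0,k}$ lies in $\langle x_1,\dots,x_n\rangle F_{0,k-1}$.
   Context: $\mathbb K$ is a field, $R=\mathbb K[x_1,\dots,x_n]$. $G$ is given by a symmetric adjacency matrix $A_G=(a_{ij})$ of nonnegative integers. $M_G=\langle \mathbf x^{S\to\overline S}:\emptyset\ne S\subseteq[n-1]\rangle$, where $\mathbf x^{S\to\overline S}=\prod_{i\in S}x_i^{\sum_{j\in[n]\setminus S}a_{ij}}$. A connected $k$-partition is a set partition $\Pi$ of $[n]$ into $k$ nonempty parts, each inducing a connected subgraph of $G$. $G_\Pi$ is the graph on the set $\Pi$ in which distinct parts $U,W$ are joined by one edge iff $\sum_{u\in U,w\in W}a_{uw}>0$. An acyclic $k$-partition $\mathcal C$ is a connected $k$-partition $\Pi(\mathcal C)$ together with an acyclic orientation of $G_{\Pi(\mathcal C)}$, regarded as a directed graph on $\Pi(\mathcal C)$; it is $n$-acyclic if its unique sink is the part containing $n$. For $u\in U\in\Pi(\mathcal C)$ put $out_{\mathcal C}(u)=\sum_{W:(U,W)\in\mathcal C}\sum_{w\in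 W}a_{uw}$ and $D(\mathcal C)=(out_{\mathcal C}(u))_{u\in[n]}$. An edge $e=(e^-,e^+)$ of $\mathcal C$ (directed from $e^-$ to $e^+$) is contractible if the directed graph $\mathcal C/e$ obtained by merging $e^-,e^+$ into $e^-\cup e^+$ (and deleting $e$) has no directed cycle (including 2-cycles); then $\mathcal C/e$ is an acyclic $(k-1)$-partition, which is $n$-acyclic if $\mathcal C$ is. Put $m_{\mathcal C}(e)=\mathbf x^{D(\mathcal C)-D(\mathcal C/e)}$, and let $f/e$ denote the edge of $\mathcal C/e$ induced by an edge $f\neq e$. Fix functions $\operatorname{sign}_{\mathcal C}$ from the contractible edges of $\mathcal C$ to $\{\pm1\}$, for every $n$-acyclic $k$-partition $\mathcal C$ (all $k$), such that $\operatorname{sign}_{\mathcal C}(e)\operatorname{sign}_{\mathcal C/e}(f/e)=-\operatorname{sign}_{\mathcal C}(f)\operatorname{sign}_{\mathcal C/f}(e/f)$ whenever $e\ne f$ are contractible edges of $\mathcal C$ with $f/e$ contractible in $\mathcal C/e$ and $e/f$ contractible in $\mathcal C/f$. (Such functions exist.) For $0\le k\le n-1$, $F_{0,k}=\bigoplus_{\mathcal C}R(-D(\mathcal C))$ with one basis element (also denoted $\mathcal C$) for each $n$-acyclic $(k+1)$-partition $\mathcal C$ of $G$, and $\delta_{0,k}:F_{0,k}\to F_{0,k-1}$ is given by $\delta_{0,k}(\mathcal C)=\sum_e\operatorname{sign}_{\mathcal C}(e)\,m_{\mathcal C}(e)\,(\mathcal C/e)$, summed over the contractible edges $e$ of $\mathcal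 C$. *)

(* Defs.v *)
From HB Require Import structures.
From mathcomp Require Import all_boot all_order all_algebra.
From mathcomp Require Import mpoly.

Set Implicit Arguments.
Unset Strict Implicit.
Unset Printing Implicit Defensive.

Import GRing.Theory.
Local Open Scope ring_scope.

(* The vertex set [n] of the paper is 'I_n.+1 here, so that n >= 1 is built in; *)
(* the distinguished vertex "n" is ord_max.                                     *)

Definition part n := {set 'I_n.+1}.

Section Graph.
Variables (n : nat) (A : 'M[nat]_n.+1).
Implicit Types (u v : 'I_n.+1) (U W : part n).

Definition induced_connected U : bool :=
  [forall u in U, forall v in U,
     connect [rel x y | [&& x \in U, y \in U & (0 < A x y)%N]] u v].

Definition connected_graph : bool := induced_connected [set: 'I_n.+1].

Definition connected_partition (k : nat) (P : {set part n}) : bool :=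
  [&& partition P [set: 'I_n.+1], #|P| == k & [forall U in P, induced_connected U]].

Definition quot_adj (P : {set part n}) : rel (part n) := fun U W =>
  [&& U \in P, W \in P, U != W & (0 < \sum_(u in U) \sum_(w in W) A u w)%N].

End Graph.

(* A directed graph on a set of parts: its vertices and its arcs (U, W), *)
(* directed from U to W.                                                 *)
Definition pgraph n := ({set part n} * {set part n * part n})%type.

Section PGraph.
Variable n : nat.
Implicit Types (C : pgraph n) (e f : part n * part n) (U W : part n).

Definition parts C : {set part n} := C.1.
Definition arcs C : {set part n * part n} := C.2.
Definition arc C : rel (part n) := fun U W => (U, W) \in arcs C.

(* A directed cycle is an arc U -> W together with a directed path from W to U. *)
Definition acyclic C : bool :=
  [forall U, forall W, arc C U W ==> ~~ connect (arc C) W U].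

Definition is_sink C U : bool :=
  (U \in parts C) && [forall W, ~~ arc C U W].

Definition merge e U : part n :=
  if (U == e.1) || (U == e.2) then e.1 :|: e.2 else U.

(* f/e, the arc of C/e induced by f. *)
Definition induced_arc e f : part n * part n := (merge e f.1, merge e f.2).

(* C/e *)
Definition contract C e : pgraph n :=
  (merge e @: parts C, induced_arc e @: (arcs C :\ e)).

Definition contractible C e : bool := (e \in arcs C) && acyclic (contract C e).

End PGraph.

Section AcyclicPartitions.
Variables (n : nat) (A : 'M[nat]_n.+1).
Implicit Types (C : pgraph n) (e : part n * part n) (u : 'I_n.+1).

Definition orientation C : bool :=
  [forall U, forall W,
     ((arc C U W || arc C W U) == quot_adj A (parts C) U W)
     && ~~ (arc C U W && arc C W U)].

Definition acyclic_partition (k : nat) C : bool :=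
  [&& connected_partition A k (parts C), orientation C & acyclic C].

Definition n_acyclic (k : nat) C : bool :=
  acyclic_partition k C &&
  [forall U in parts C, is_sink C U == (ord_max \in U)].

Definition outdeg C u : nat :=
  \sum_(W | arc C (pblock (parts C) u) W) \sum_(w in W) A u w.

Definition D C : 'X_{1..n.+1} := [multinom outdeg C u | u < n.+1].

End AcyclicPartitions.

Section Complex.
Variables (K : fieldType) (n : nat) (A : 'M[nat]_n.+1).
Local Notation R := {mpoly K[n.+1]}.

Definition cut_monomial (S : {set 'I_n.+1}) : R :=
  \prod_(i in S) 'X_i ^+ (\sum_(j in ~: S) A i j)%N.

Definition in_MG (p : R) : Prop :=
  exists c : {set 'I_n.+1} -> R,
    p = \sum_(S : {set 'I_n.+1} | (S != set0) && (ord_max \notin S))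
          c S * cut_monomial S.

(* The monomial subtraction is truncated, but D (C/e) <= D C whenever e is a *)
(* contractible arc of an acyclic partition C.                               *)
Definition arc_monomial (C : pgraph n) (e : part n * part n) : R :=
  'X_[(D A C - D A (contract C e))%MM].

Definition basis_index (k : nat) := {C : pgraph n | n_acyclic A k.+1 C}.

(* R^o makes this a module over R rather than over K. *)
Definition F (k : nat) := {ffun basis_index k -> R^o}.

(* This is 0 when C does not index a basis element of F k; that does not happen *)
(* for the contractions C/e occurring in the differential.                     *)
Definition basis_vec (k : nat) (C : pgraph n) : F k :=
  [ffun C' : basis_index k => (val C' == C)%:R].

Definition sign_function := pgraph n -> part n * part n -> int.

(* Values of sgn on other arguments are irrelevant. *)
Definition valid_sign (sgn : sign_function) : Prop :=
  (forall k C e, n_acyclic A k C -> contractible C e ->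
     sgn C e = 1 \/ sgn C e = -1) /\
  (forall k C e f, n_acyclic A k C -> e <> f ->
     contractible C e -> contractible C f ->
     contractible (contract C e) (induced_arc e f) ->
     contractible (contract C f) (induced_arc f e) ->
     sgn C e * sgn (contract C e) (induced_arc e f)
     = - (sgn C f * sgn (contract C f) (induced_arc f e))).

Definition delta_basis (sgn : sign_function) (k : nat) (C : pgraph n) : F k :=
  \sum_(e | contractible C e)
    ((sgn C e)%:~R * arc_monomial C e) *: basis_vec k (contract C e).

(* delta sgn k is the differential leaving homological degree k + 1. *)
Definition delta (sgn : sign_function) (k : nat) (f : F k.+1) : F k :=
  \sum_(C : basis_index k.+1) f C *: delta_basis sgn k (val C).

Fact delta_is_linear sgn k : linear (@delta sgn k).
Proof.
move=> a f g; rewrite /delta scaler_sumr -big_split /=; apply: eq_bigr => C _.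
by rewrite !ffunE scalerDl scalerA.
Qed.
HB.instance Definition _ sgn k :=
  GRing.isLinear.Build R (F k.+1) (F k) _ (@delta sgn k) (@delta_is_linear sgn k).

(* Homogeneous of multidegree d in (+)_C R(-D(C)): the generator C has degree D C. *)
Definition homogeneous (k : nat) (d : 'X_{1..n.+1}) (f : F k) : Prop :=
  forall C : basis_index k, forall m, m \in msupp (f C) -> (m + D A (val C))%MM = d.

(* The identification of F_0, which has a single basis element, with R. *)
Definition F0_to_R (f : F 0) : R := \sum_(C : basis_index 0) f C.

(* v lies in <x_1, ..., x_n> F_k *)
Definition in_mF (k : nat) (v : F k) : Prop :=
  exists g : 'I_n.+1 -> F k, v = \sum_i 'X_i *: g i.

End Complex.

(* Main.v *)
(* Acyclic partitions are the types of integer rank functions r on the vertices: *)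
(* the parts are the components of the level sets, arcs point downwards, and     *)
(* out(u) is the sum of the A u w with r w < r u. Contracting an arc makes r     *)
(* equal on its ends.                                                            *)
(*                                                                               *)
(* In multidegree b the complex has as basis the cells C with D(C) <= b. The     *)
(* sets S avoiding n whose cut is bounded by b are closed under union; let S* be *)
(* the largest. The complement of S* is connected, and contained in the sink     *)
(* part P of every such C. If S* is not empty, look at the local minima of C     *)
(* restricted to S*: each is either a part whose only out-neighbour is P, or has *)
(* been absorbed in P. Absorbing or releasing the one with the smallest maximal  *)
(* vertex (the pivot) is a perfect matching of the cells, and gradient paths     *)
(* strictly decrease the size of P. Hence the strand is exact.                   *)

Require Import Defs.
From HB Require Import structures.
From mathcomp Require Import all_boot all_order all_algebra.
From mathcomp Require Import mpoly.
From mathcomp Require Import zify.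

Set Implicit Arguments.
Unset Strict Implicit.
Unset Printing Implicit Defensive.

Import GRing.Theory.

(** The complex is multigraded, and a generator C contributes at most one monomial to a given
    multidegree d. So every question splits into finite-dimensional ones: the strand in degree d has
    as basis over [K] the cells C with D(C) <= d, the monomials of the differential become 1, and
    what remains is the signed incidence matrix [incid] ([strand_delta]).

    Rank functions make the cells tractable: a cell is recovered from any of its rank functions
    ([cell_of_ranks]), and C/e is the cell of any rank function that ties exactly the ends of e
    ([contract_cell]). Two successive contractions can be made in exactly one other order
    ([contraction_diamond], [induced_arc_inj]), and the sign rule cancels the two terms
    ([incid_incid]); hence a complex.

    If no nonempty cut is bounded by d, only the one-part cell can lie in the strand
    ([bounded_cell_no_cut]), so there is nothing in positive degree. Otherwise the pivot matching
    ([lower_partner], [upper_partner]), fed into [matching_exact], shows that the strand is exact,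
    degree zero included ([strand_exact]). So the degree-zero generator survives in degree d
    precisely when no cut monomial divides x^d, which gives the cokernel R/M_G ([in_MGP]).
    Minimality holds because contracting an arc strictly lowers some outdegree ([D_contract]). *)

Local Notation merge := Defs.merge.
Local Notation arc := Defs.arc.

(** * Blocks of a partition *)

Section Blocks.
Variables (T : finType) (P : {set {set T}}).
Hypothesis partP : partition P [set: T].
Implicit Types (x y : T) (U W : {set T}).

Let covP x : x \in cover P. Proof. by rewrite (cover_partition partP) inE. Qed.

Lemma block_in x : pblock P x \in P. Proof. exact: pblock_mem. Qed.

Lemma mem_block x : x \in pblock P x. Proof. by rewrite mem_pblock. Qed.

Lemma blockE U x : U \in P -> x \in U -> pblock P x = U.
Proof. exact: def_pblock (partition_trivIset partP). Qed.

Lemma part_block U : U \in P -> exists2 x, x \in U & U = pblock P x.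
Proof.
move=> UP; have /set0Pn[x xU]: U != set0.
  by case/and3P: partP => _ _; apply: contra => /eqP<-.
by exists x => //; rewrite (blockE UP xU).
Qed.

Lemma mem_blockE x y : (y \in pblock P x) = (pblock P y == pblock P x).
Proof.
apply/idP/eqP => [yx|<-]; last exact: mem_block.
exact: blockE (block_in x) yx.
Qed.

Lemma part_disj U W x : U \in P -> W \in P -> x \in U -> x \in W -> U = W.
Proof. by move=> UP WP xU xW; rewrite -(blockE UP xU) (blockE WP xW). Qed.

End Blocks.

(** * Merging two blocks *)

Section Merge.
Variables (n : nat) (P : {set part n}) (e : part n * part n).
Hypotheses (partP : partition P [set: 'I_n.+1]).
Hypotheses (e1P : e.1 \in P) (e2P : e.2 \in P).
Implicit Types (x y : 'I_n.+1) (U W : part n).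

Lemma mergeP U W : U \in P -> W \in P ->
  reflect (U = W \/ (U = e.1 \/ U = e.2) /\ (W = e.1 \/ W = e.2))
          (merge e U == merge e W).
Proof.
(* The merged block cannot coincide by accident with an untouched part: such a part would meet
   [e.1]. *)
move=> UP WP; have inM Z : Z \in P -> Z = e.1 :|: e.2 -> Z = e.1.
  move=> ZP ZE; have [x x1 _] := part_block partP e1P.
  by apply: (part_disj partP ZP e1P _ x1); rewrite ZE inE x1.
rewrite /merge; case: ifPn => [/orP hU|]; case: ifPn => [/orP hW|].
- rewrite eqxx; constructor; right.
  by split; [case: hU|case: hW] => /eqP; tauto.
- rewrite negb_or => /andP[/eqP W1 /eqP W2]; apply: (iffP eqP) => [/esym/(inM _ WP)//|].
  by case=> [UW|[_ []]//]; case: hU => /eqP; congruence.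
- rewrite negb_or => /andP[/eqP U1 /eqP U2]; apply: (iffP eqP) => [/(inM _ UP)//|].
  by case=> [UW|[[]//]]; case: hW => /eqP; congruence.
rewrite !negb_or => /andP[/eqP W1 /eqP W2] /andP[/eqP U1 /eqP U2].
by apply: (iffP eqP) => [|[|[[]//]]]; [left|].
Qed.

Lemma merge_id U : U != e.1 -> U != e.2 -> merge e U = U.
Proof. by rewrite /merge => /negPf-> /negPf->. Qed.

Lemma merge1 : merge e e.1 = e.1 :|: e.2. Proof. by rewrite /merge eqxx. Qed.
Lemma merge2 : merge e e.2 = e.1 :|: e.2. Proof. by rewrite /merge eqxx orbT. Qed.

Lemma mem_merge_block x y :
  (y \in merge e (pblock P x)) = (merge e (pblock P y) == merge e (pblock P x)).
Proof.
have xP := block_in partP x; have yP := block_in partP y.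
have sub U : U \in P -> y \in U -> pblock P y = U by exact: blockE.
apply/idP/(mergeP yP xP).
  rewrite {1}/merge; case: ifPn => [/orP hx|_ /(sub _ xP) ->]; last by left.
  by rewrite inE => /orP[] /(sub _ _)->//; right; case: hx => /eqP; tauto.
move=> h; have yy := mem_block partP y.
case: h => [<-|[hy hx]].
  by rewrite /merge; case: ifP => // /orP[] /eqP<-; rewrite inE yy ?orbT.
have -> : merge e (pblock P x) = e.1 :|: e.2.
  by case: hx => ->; rewrite ?merge1 ?merge2.
by rewrite inE; case: hy => <-; rewrite yy ?orbT.
Qed.

Lemma card_merge : e.1 != e.2 -> #|merge e @: P| = #|P|.-1.
Proof.
move=> e12; rewrite (cardsD1 e.2 P) e2P /=.
have -> : merge e @: P = merge e @: (P :\ e.2).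
  apply/eqP; rewrite eqEsubset (imsetS _ (subD1set _ _)) andbT.
  apply/subsetP => _ /imsetP[U UP ->].
  have [->|U2] := eqVneq U e.2.
    by rewrite merge2 -merge1; apply: imset_f; rewrite !inE e12.
  by apply: imset_f; rewrite !inE U2.
rewrite card_in_imset // => U W /setD1P[U2 UP] /setD1P[W2 WP] /eqP/(mergeP UP WP).
by case=> // -[[->|/eqP]]; rewrite ?(negPf U2) // => -[->|/eqP]; rewrite ?(negPf W2).
Qed.

Lemma merge_partition : partition (merge e @: P) [set: 'I_n.+1].
Proof.
have blk x : merge e (pblock P x) \in merge e @: P by rewrite imset_f ?block_in.
have mm x : x \in merge e (pblock P x) by rewrite mem_merge_block.
have E U x : U \in merge e @: P -> x \in U -> U = merge e (pblock P x).
  case/imsetP => W /(part_block partP)[y _ ->] ->.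
  by rewrite mem_merge_block => /eqP->.
apply/and3P; split.
- apply/eqP/setP => x; rewrite inE; apply/bigcupP.
  by exists (merge e (pblock P x)).
- apply/trivIsetP => U W UP WP; apply: contraR => /pred0Pn[x /andP[/= xU xW]].
  by rewrite (E _ _ UP xU) (E _ _ WP xW).
- apply/imsetP => -[U /(part_block partP)[y _ ->]] E0.
  by have := mm y; rewrite -E0 inE.
Qed.

Lemma pblock_merge x : pblock (merge e @: P) x = merge e (pblock P x).
Proof.
by apply: (blockE merge_partition); rewrite ?mem_merge_block // imset_f ?block_in.
Qed.

End Merge.

Lemma connect_ind (T : finType) (e : rel T) (P : T -> Prop) x :
  P x -> (forall y z, connect e x y -> P y -> e y z -> P z) ->
  forall y, connect e x y -> P y.
Proof.
move=> Px step y /connectP[p + ->]; elim/last_ind: p => //= p z IH.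
rewrite rcons_path last_rcons => /andP[xp ez]; apply: step ez; last exact: IH.
by apply/connectP; exists p.
Qed.

Lemma induced_connectedP n (A : 'M[nat]_n.+1) (U : part n) :
  reflect {in U &, forall u v, connect
            [rel x y | [&& x \in U, y \in U & (0 < A x y)%N]] u v}
          (induced_connected A U).
Proof.
apply: (iffP forall_inP) => h u; last by move=> uU; apply/forall_inP => v; apply: h.
by move=> v /h/forall_inP; apply.
Qed.

(** * Acyclic partitions as cells of rank functions *)

Section Cells.
Variables (n : nat) (A : 'M[nat]_n.+1).
Hypothesis A_sym : forall i j, A i j = A j i.
Local Notation V := 'I_n.+1.
Implicit Types (r : V -> nat) (x y u w : V) (U W : part n) (C : pgraph n).

Definition level r : rel V := [rel u w | (0 < A u w)%N && (r u == r w)].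

Definition lcomp r u : part n := [set w | connect (level r) u w].

(* Every acyclic partition has this form, for instance with [r u] the number of *)
(* parts reachable from the part of [u].                                        *)
Definition cell r : pgraph n :=
  ([set lcomp r u | u in [set: V]],
   [set (lcomp r p.1, lcomp r p.2) | p in [set p : V * V |
      (0 < A p.1 p.2)%N && (r p.2 < r p.1)%N]]).

Lemma levelE r x y : level r x y = (0 < A x y)%N && (r x == r y).
Proof. by []. Qed.

Lemma level_csym r : connect_sym (level r).
Proof. by apply: sym_connect_sym => x y; rewrite !levelE A_sym eq_sym. Qed.

Lemma mem_compE r x y : (y \in lcomp r x) = (lcomp r y == lcomp r x).
Proof.
rewrite inE; apply/idP/eqP => [xy|/setP/(_ y)]; last by rewrite !inE connect0.
by apply/setP => z; rewrite !inE (same_connect (level_csym r) xy).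
Qed.

Lemma mem_comp r x : x \in lcomp r x. Proof. by rewrite inE connect0. Qed.

Lemma comp_level r x y : (0 < A x y)%N -> r x = r y -> lcomp r x = lcomp r y.
Proof.
by move=> a E; apply/esym/eqP; rewrite -mem_compE inE connect1 // levelE a E eqxx.
Qed.

Lemma rank_comp r x y : y \in lcomp r x -> r y = r x.
Proof.
by rewrite inE; elim/connect_ind => // z t _ <- /andP[_ /eqP].
Qed.

Lemma comp_rank r x y : lcomp r x = lcomp r y -> r x = r y.
Proof. by move/eqP; rewrite -mem_compE => /rank_comp. Qed.

Lemma cell_partition r : partition (parts (cell r)) [set: V].
Proof.
apply/and3P; split.
- apply/eqP/setP => x; rewrite inE; apply/bigcupP.
  by exists (lcomp r x); rewrite ?mem_comp ?imset_f.
- apply/trivIsetP => _ _ /imsetP[x _ ->] /imsetP[y _ ->].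
  apply: contraR => /pred0Pn[z /andP[/= ]].
  by rewrite !mem_compE => /eqP-> .
- by apply/imsetP => -[x _ E0]; have := mem_comp r x; rewrite -E0 inE.
Qed.

Lemma pblock_cell r x : pblock (parts (cell r)) x = lcomp r x.
Proof. by apply: (blockE (cell_partition r)); rewrite ?imset_f ?mem_comp. Qed.

Lemma comp_connected r x : induced_connected A (lcomp r x).
Proof.
apply/induced_connectedP => y z; rewrite !mem_compE => /eqP<-.
rewrite -mem_compE inE; elim/connect_ind => [|s t ys IH st]; first exact: connect0.
apply: connect_trans IH (connect1 _) => /=.
case/andP: (st) => -> _; rewrite !inE ys !andbT /=.
exact: connect_trans ys (connect1 st).
Qed.

Lemma arc_cellP r U W :
  reflect (exists x y, [/\ U = lcomp r x, W = lcomp r y, (0 < A x y)%N & (r y < r x)%N])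
          (arc (cell r) U W).
Proof.
apply: (iffP imsetP) => [[[x y]]|[x [y [-> -> a l]]]].
  by rewrite inE => /andP[/= a l] [-> ->]; exists x, y.
by exists (x, y) => //; rewrite inE /= a.
Qed.

Lemma arc_cell_rank r x y : arc (cell r) (lcomp r x) (lcomp r y) -> (r y < r x)%N.
Proof. by case/arc_cellP => z [t [/comp_rank-> /comp_rank->]]. Qed.

Lemma quot_adjP P U W : partition P [set: V] ->
  reflect (exists x y, [/\ U = pblock P x, W = pblock P y, U <> W & (0 < A x y)%N])
          (quot_adj A P U W).
Proof.
move=> hP; apply: (iffP and4P) => [[UP WP /eqP UW]|[x [y [-> -> E a]]]].
  rewrite lt0n sum_nat_eq0 negb_forall => /existsP[x].
  rewrite negb_imply sum_nat_eq0 negb_forall => /andP[xU /existsP[y]].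
  rewrite negb_imply -lt0n => /andP[yW a].
  by exists x, y; rewrite (blockE hP UP xU) (blockE hP WP yW).
split; [exact: block_in|exact: block_in|exact/eqP|].
rewrite (bigD1 x) ?mem_block //= (bigD1 y) ?mem_block //=.
by lia.
Qed.

Lemma acyclicP C :
  reflect (exists r : part n -> nat, forall U W, arc C U W -> (r W < r U)%N)
          (acyclic C).
Proof.
apply: (iffP idP) => [aC|[r rC]].
  exists (fun U => #|[set Z | connect (arc C) U Z]|) => U W UW.
  apply: proper_card; apply/properP; split.
    by apply/subsetP => Z; rewrite !inE; apply: connect_trans (connect1 UW).
  exists U; rewrite inE ?connect0 //.
  by move/forallP: aC => /(_ U)/forallP/(_ W); rewrite UW.
apply/forallP => U; apply/forallP => W; apply/implyP => UW; apply/negP => WU.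
suff: (r U <= r W)%N by rewrite leqNgt rC.
by move: U WU {UW}; apply: connect_ind => // Y Z _ YW /rC/ltnW/leq_trans; apply.
Qed.

Lemma cell_acyclic_partition r :
  acyclic_partition A #|parts (cell r)| (cell r).
Proof.
have hP := cell_partition r.
apply/and3P; split.
- rewrite /connected_partition hP eqxx /=.
  by apply/forall_inP => _ /imsetP[x _ ->]; apply: comp_connected.
- apply/forallP => U; apply/forallP => W; apply/andP; split.
    apply/eqP; apply/idP/(quot_adjP _ _ hP) => [/orP[]|[x [y]]].
    + case/arc_cellP => x [y [-> -> a l]]; exists x, y; rewrite !pblock_cell.
      by split => // /comp_rank E; rewrite E ltnn in l.
    + case/arc_cellP => x [y [-> -> a l]]; exists y, x; rewrite !pblock_cell A_sym.
      by split => // /comp_rank E; rewrite E ltnn in l.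
    rewrite !pblock_cell => -[-> -> E a].
    case: (ltngtP (r x) (r y)) => l; last by case: E; apply: comp_level.
      by apply/orP; right; apply/arc_cellP; exists y, x; rewrite A_sym.
    by apply/orP; left; apply/arc_cellP; exists x, y.
  apply/negP => /andP[/arc_cellP[x [y [-> -> _ l]]] /arc_cell_rank].
  by rewrite ltnNge ltnW.
- apply/forallP => U; apply/forallP => W; apply/implyP.
  case/arc_cellP => x [y [-> -> _ l]]; apply/negP => c.
  suff: forall Z, connect (arc (cell r)) (lcomp r y) Z ->
      forall z, Z = lcomp r z -> (r z <= r y)%N.
    by move/(_ _ c x erefl); rewrite leqNgt l.
  move=> Z; elim/connect_ind => [z /comp_rank->//|S T _ IH].
  case/arc_cellP => s [t [/IH st -> _ ts]] z /comp_rank<-.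
  by apply: ltnW (leq_trans ts st).
Qed.

Section OfPartition.
Variables (k : nat) (C : pgraph n).
Hypothesis aC : acyclic_partition A k C.
Local Notation blk := (pblock (parts C)).

Lemma acyclic_part : partition (parts C) [set: V].
Proof. by case/and3P: aC => /and3P[]. Qed.
Local Notation hP := acyclic_part.

Lemma card_parts : #|parts C| = k.
Proof. by case/and3P: aC => /and3P[_ /eqP]. Qed.

Lemma part_connected U : U \in parts C -> induced_connected A U.
Proof. by case/and3P: aC => /and3P[_ _ /forall_inP h] _ _; apply: h. Qed.

Lemma arcE U W : (arc C U W || arc C W U) = quot_adj A (parts C) U W.
Proof. by case/and3P: aC => _ /forallP/(_ U)/forallP/(_ W)/andP[/eqP]. Qed.

Lemma arc_asym U W : arc C U W -> ~~ arc C W U.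
Proof.
by case/and3P: aC => _ /forallP/(_ U)/forallP/(_ W)/andP[_]; case: (arc C U W).
Qed.

Lemma arcP U W : arc C U W ->
  exists x y, [/\ U = blk x, W = blk y, U <> W & (0 < A x y)%N].
Proof.
by move=> UW; apply/(quot_adjP _ _ hP); rewrite -arcE UW.
Qed.

Lemma arc_in U W : arc C U W -> U \in parts C /\ W \in parts C.
Proof. by case/arcP => x [y [-> -> _ _]]; split; apply: block_in hP _. Qed.

Lemma edge_arc x y : (0 < A x y)%N -> blk x <> blk y ->
  arc C (blk x) (blk y) \/ arc C (blk y) (blk x).
Proof.
by move=> a E; apply/orP; rewrite arcE; apply/(quot_adjP _ _ hP); exists x, y.
Qed.

Definition ranks C r :=
  (forall x y, pblock (parts C) x = pblock (parts C) y -> r x = r y) /\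
  (forall x y, arc C (pblock (parts C) x) (pblock (parts C) y) -> (r y < r x)%N).

(** Adjacent vertices in different blocks are joined by an arc, so their ranks differ; hence the
    components of the level sets of [r] are exactly the connected blocks, and the direction of each
    arc is read off from [r]. *)
Lemma cell_of_ranks r : ranks C r -> C = cell r.
Proof.
case=> r0 r1.
have lev x y : level r x y -> blk x = blk y.
  move=> /andP[a /eqP xy]; apply/eqP/negPn/negP => /eqP.
  by case/(edge_arc a) => /r1; rewrite xy ltnn.
have E x : blk x = lcomp r x.
  apply/setP => y; rewrite (mem_blockE hP) [RHS]inE; apply/eqP/idP => [yx|].
    have: y \in blk x by rewrite (mem_blockE hP) yx.
    move/(induced_connectedP _ _ (part_connected (block_in hP x)) _ _ (mem_block hP x)).
    apply: connect_sub => s t /and3P[]; rewrite !(mem_blockE hP) => /eqP sx /eqP tx a.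
    by rewrite connect1 // levelE a (r0 s t) ?sx ?tx /=.
  by elim/connect_ind => // s t _ <- /lev.
have PE : parts C = parts (cell r).
  apply/setP => U; apply/idP/imsetP => [/(part_block hP)[x _ ->]|[x _ ->]].
    by exists x; rewrite ?inE ?E.
  by rewrite -E block_in ?hP.
rewrite [LHS]surjective_pairing [RHS]surjective_pairing; congr (_, _) => //.
apply/setP => -[U W]; apply/idP/idP => [UW|].
  case: (arcP UW) => x [y [Ux Wy _ a]]; apply/arc_cellP; exists x, y.
  by rewrite -!E; split => //; apply: r1; rewrite -Ux -Wy.
case/arc_cellP => x [y [-> -> a l]]; rewrite -!E.
case: (edge_arc a) => [/r0 xy||/r1]; rewrite ?xy ?ltnn // in l *.
by rewrite ltnNge ltnW.
Qed.

Lemma ranks_exists : exists r, ranks C r.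
Proof.
case/and3P: aC => _ _ /acyclicP[r rC].
by exists (fun x => r (blk x)); split => [x y ->|x y /rC].
Qed.

End OfPartition.

Lemma cell_ranks r : ranks (cell r) r.
Proof.
by split=> x y; rewrite !pblock_cell; [apply: comp_rank|apply: arc_cell_rank].
Qed.

(* A rank function of [C/e], pulled back to [C]. *)
Definition collapses C e r :=
  [/\ forall x y, pblock (parts C) x = pblock (parts C) y -> r x = r y,
      forall x y, pblock (parts C) x = e.1 -> pblock (parts C) y = e.2 -> r x = r y
    & forall x y, arc C (pblock (parts C) x) (pblock (parts C) y) ->
        (pblock (parts C) x, pblock (parts C) y) <> e -> (r y < r x)%N].

(** * Contraction in terms of rank functions *)

Section Contract.
Variables (k : nat) (C : pgraph n) (e : part n * part n).
Hypotheses (aC : acyclic_partition A k C) (eC : e \in arcs C).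
Local Notation blk := (pblock (parts C)).
Let hP := acyclic_part aC.

Lemma arc_ends : [/\ e.1 \in parts C, e.2 \in parts C & e.1 <> e.2].
Proof.
have: arc C e.1 e.2 by rewrite /Defs.arc -surjective_pairing.
by case/(arcP aC) => x [y [Ex Ey E _]]; rewrite {1}Ex {1}Ey !block_in.
Qed.

Lemma pblock_contract x : pblock (parts (contract C e)) x = merge e (blk x).
Proof. by case: arc_ends => *; apply: pblock_merge. Qed.

Lemma contractible_collapses : contractible C e -> exists r, collapses C e r.
Proof.
case/andP => _ /acyclicP[r rC]; exists (fun x => r (merge e (blk x))).
split=> [x y ->//|x y -> ->|x y xy ne]; first by rewrite merge1 merge2.
apply: rC; apply/imsetP; exists (blk x, blk y) => //.
by rewrite !inE; apply/andP; split => //; apply/eqP.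
Qed.

(** The argument of [cell_of_ranks], except that one tie between different blocks is now allowed,
    namely across [e]; an edge of the graph underlying [e] connects the two blocks inside their
    common level. *)
Lemma contract_cell r : collapses C e r -> contract C e = cell r.
Proof.
case=> r0 re r1; have [e1P e2P e12] := arc_ends.
have lev x y : level r x y -> merge e (blk x) = merge e (blk y).
  move=> /andP[a /eqP xy]; have [->//|/eqP ne] := eqVneq (blk x) (blk y).
  case: (edge_arc aC a ne) => h.
    have [<-|/eqP ee] := eqVneq (blk x, blk y) e; first by rewrite merge1 merge2.
    by have := r1 _ _ h ee; rewrite xy ltnn.
  have [<-|/eqP ee] := eqVneq (blk y, blk x) e; first by rewrite merge1 merge2.
  by have := r1 _ _ h ee; rewrite xy ltnn.
have inpart x y : blk x = blk y -> connect (level r) x y.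
  move=> xy; have: y \in blk x by rewrite (mem_blockE hP) xy.
  move/(induced_connectedP _ _ (part_connected aC (block_in hP x)) _ _ (mem_block hP x)).
  apply: connect_sub => s t /and3P[]; rewrite !(mem_blockE hP) => /eqP sx /eqP tx a.
  by rewrite connect1 // levelE a (r0 s t) ?sx ?tx /=.
have cross x y : blk x = e.1 -> blk y = e.2 -> connect (level r) x y.
  have: arc C e.1 e.2 by rewrite /Defs.arc -surjective_pairing.
  case/(arcP aC) => s [t [es et _ a]] xe ye.
  apply: (@connect_trans _ _ s); first by apply: inpart; rewrite xe.
  apply: (@connect_trans _ _ t); last by apply: inpart; rewrite ye.
  by rewrite connect1 // levelE a (re s t) //=.
have E x : merge e (blk x) = lcomp r x.
  apply/setP => y; rewrite (mem_merge_block hP e1P e2P) [RHS]inE; apply/idP/idP.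
    move/(mergeP hP e1P (block_in hP y) (block_in hP x)).
    case=> [yx|[[] Ey [] Ex]]; try (by apply: inpart; rewrite ?yx ?Ex ?Ey);
      last exact: cross.
    by rewrite level_csym; apply: cross.
  by elim/connect_ind => // s t _ /eqP<- /lev->.
rewrite [LHS]surjective_pairing [RHS]surjective_pairing; congr (_, _).
  apply/setP => U; apply/imsetP/imsetP => [[_ /(part_block hP)[x _ ->] ->]|[x _ ->]].
    by exists x; rewrite ?inE ?E.
  by exists (blk x); rewrite ?block_in ?E.
apply/setP => -[U W]; apply/imsetP/(arc_cellP r U W).
  case=> -[X Y] /setD1P[/eqP ne h] [-> ->].
  case: (arcP aC h) => x [y [Ex Ey _ a]]; subst X Y; exists x, y.
  by rewrite /= !E; split => //; apply: r1.
case=> x [y [-> -> a l]]; exists (blk x, blk y); last by rewrite /induced_arc /= !E.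
have nxy : blk x <> blk y by move/r0=> xy; rewrite xy ltnn in l.
apply/setD1P; split.
  by apply/eqP => ee; rewrite (re x y) ?ltnn // -ee in l.
case: (edge_arc aC a nxy) => // h; exfalso.
have [ee|/eqP ee] := eqVneq (blk y, blk x) e.
  by rewrite (re y x) ?ltnn // -ee in l.
by have := r1 _ _ h ee; rewrite ltnNge ltnW.
Qed.

Lemma collapses_contractible r : collapses C e r -> contractible C e.
Proof.
move=> rC; apply/andP; split => //; rewrite (contract_cell rC).
by case/and3P: (cell_acyclic_partition r).
Qed.

Lemma contract_acyclic_partition :
  contractible C e -> acyclic_partition A k.-1 (contract C e).
Proof.
move=> ce; have [r rC] := contractible_collapses ce.
have [e1P e2P /eqP e12] := arc_ends.
have -> : k.-1 = #|parts (contract C e)|.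
  by rewrite (card_merge hP) // (card_parts aC).
by rewrite (contract_cell rC); apply: cell_acyclic_partition.
Qed.

(* Doubling leaves room for separating the ends of [e] again. *)
Lemma expand_ranks r : collapses C e r ->
  ranks C (fun x => (2 * r x + (x \in e.1))%N).
Proof.
have [e1P e2P e12] := arc_ends.
case=> r0 re r1; split=> [x y xy|x y xy].
    congr (2 * _ + nat_of_bool _)%N; first exact: r0.
  have [z _ ->] := part_block hP e1P.
  by rewrite !(mem_blockE hP) xy.
have [ee|/eqP ee] := eqVneq (blk x, blk y) e; last by have := r1 _ _ xy ee; lia.
have /= [ex ey] := (congr1 fst ee, congr1 snd ee).
rewrite (re x y) // -{2}ex (mem_block hP) -ex (mem_blockE hP).
by case: eqP => [E|_]; [case: e12; rewrite -ex -ey E|lia].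
Qed.

End Contract.

End Cells.

Lemma ltn_doubleD (m p : nat) (c d : bool) : (m < p -> 2 * m + c < 2 * p + d)%N.
Proof. by case: c; case: d; lia. Qed.

(** * Sinks, degrees, and the order of contractions *)

Section NAcyclic.
Variables (n : nat) (A : 'M[nat]_n.+1).
Hypothesis A_sym : forall i j, A i j = A j i.
Local Notation V := 'I_n.+1.
Implicit Types (r : V -> nat) (x y u w : V) (U W : part n) (C : pgraph n).
Implicit Types (e f g h : part n * part n).

(** The part of a vertex of least rank has no outgoing arc. If every part missing [ord_max] has one,
    that part must be the one of [ord_max], which is then the sink. *)
Lemma n_acyclicP k C :
  n_acyclic A k C <-> acyclic_partition A k C /\
    (forall x, ord_max \notin pblock (parts C) x ->
       exists W, arc C (pblock (parts C) x) W).
Proof.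
split=> [/andP[aC /forall_inP sC]|[aC oC]].
  have hP := acyclic_part aC; split=> // x nx.
  have := sC _ (block_in hP x); rewrite (negPf nx) /is_sink block_in //=.
  by move/eqP/negbT; rewrite negb_forall => /existsP[W]; rewrite negbK; exists W.
have hP := acyclic_part aC; apply/andP; split => //.
apply/forall_inP => _ /(part_block hP)[x _ ->]; rewrite /is_sink block_in //=.
have [nx|/oC[W xW]] := boolP (ord_max \in _); last first.
  by rewrite eqbF_neg; apply/forallPn; exists W; rewrite negbK.
have [r [r0 r1]] := ranks_exists aC.
have [m _ mmin] := @arg_minnP _ ord_max predT r isT.
rewrite eqb_id; apply/forallP => W; apply/negP => xW.
have hm : ord_max \in pblock (parts C) m.
  apply: contraT => /oC[Z mZ]; have [_ /(part_block hP)[z _ Ez]] := arc_in aC mZ.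
  by move: mZ; rewrite Ez => /r1; rewrite ltnNge mmin.
have [_ /(part_block hP)[z _ Ez]] := arc_in aC xW.
move: xW; rewrite Ez => /r1; rewrite (r0 x m) ?ltnNge ?mmin //.
by rewrite -(blockE hP (block_in hP x) nx) (blockE hP (block_in hP m) hm).
Qed.

Definition sink C := pblock (parts C) ord_max.

Lemma n_acyclicW k C : n_acyclic A k C -> acyclic_partition A k C.
Proof. by case/andP. Qed.

Lemma rank_max k C r x : n_acyclic A k C -> ranks C r -> (r ord_max <= r x)%N.
Proof.
case/n_acyclicP => aC oC [r0 r1]; have hP := acyclic_part aC.
have [m _ mmin] := @arg_minnP _ ord_max predT r isT.
have hm : ord_max \in pblock (parts C) m.
  apply: contraT => /oC[Z mZ]; have [_ /(part_block hP)[z _ Ez]] := arc_in aC mZ.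
  by move: mZ; rewrite Ez => /r1; rewrite ltnNge mmin.
by rewrite (r0 ord_max m) ?mmin ?(blockE hP _ hm) ?block_in.
Qed.

Lemma rank_sink k C r x : n_acyclic A k C -> ranks C r ->
  (x \in sink C) = (r x == r ord_max).
Proof.
move=> nC rC; have [aC oC] := (n_acyclicP k C).1 nC; have hP := acyclic_part aC.
have [r0 r1] := rC.
rewrite (mem_blockE hP); apply/eqP/eqP => [/r0//|xn].
apply/eqP/negPn/negP => ne.
have: ord_max \notin pblock (parts C) x by rewrite (mem_blockE hP) eq_sym.
case/oC => Z xZ; have [_ /(part_block hP)[z _ Ez]] := arc_in aC xZ.
by move: xZ; rewrite Ez => /r1; rewrite xn ltnNge (rank_max _ nC).
Qed.

Lemma sink_no_arc k C W : n_acyclic A k C -> ~~ arc C (sink C) W.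
Proof.
move=> nC; have aC := n_acyclicW nC; have hP := acyclic_part aC.
have [r rC] := ranks_exists aC; apply/negP => sW.
have [_ /(part_block hP)[z _ Ez]] := arc_in aC sW.
by move: sW; rewrite Ez => /rC.2; rewrite ltnNge (rank_max _ nC rC).
Qed.

Lemma contract_n_acyclic k C e :
  n_acyclic A k C -> contractible C e -> n_acyclic A k.-1 (contract C e).
Proof.
move=> nC ce; have [aC oC] := (n_acyclicP k C).1 nC; have hP := acyclic_part aC.
have eC : e \in arcs C by case/andP: ce.
have [e1P e2P e12] := arc_ends aC eC.
apply/n_acyclicP; split; first exact: contract_acyclic_partition.
move=> x; rewrite (pblock_contract aC eC).
have img Y W : merge e Y = merge e (pblock (parts C) x) -> arc C Y W -> (Y, W) != e ->
  exists W0, arc (contract C e) (merge e (pblock (parts C) x)) W0.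
  move=> Yx YW ne; exists (merge e W).
  by apply/imsetP; exists (Y, W); rewrite ?/induced_arc ?Yx // !inE ne.
have [hx nn|] := boolP ((pblock (parts C) x == e.1) || (pblock (parts C) x == e.2)).
  have [z _ ez] := part_block hP e2P.
  have mE: merge e e.2 = merge e (pblock (parts C) x).
    by case/orP: hx => /eqP->; rewrite ?merge1 ?merge2.
  have: ord_max \notin e.2.
    by apply: contra nn; rewrite -mE merge2 inE => ->; rewrite orbT.
  rewrite ez => /oC[W]; rewrite -ez => zW; apply: (img _ _ mE zW).
  by apply/negP => /eqP/(congr1 fst)/= E; case: e12.
rewrite negb_or => /andP[n1 n2]; rewrite (merge_id n1 n2) => /oC[W xW].
rewrite -(merge_id n1 n2); apply: img xW _ => //.
by apply: contra n1 => /eqP<-.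
Qed.

(** Along an edge, an arc between blocks is the same as a strict drop of [r], and non-edges
    contribute 0; so D(C) can be compared for different cells through their rank functions alone. *)
Lemma outdegE k C r u : acyclic_partition A k C -> ranks C r ->
  outdeg A C u = (\sum_(w | r w < r u) A u w)%N.
Proof.
move=> aC rC; rewrite (cell_of_ranks aC rC) /outdeg pblock_cell //.
have hP := cell_partition A_sym r.
transitivity (\sum_(w | arc (cell A r) (lcomp A r u) (lcomp A r w)) A u w)%N.
  rewrite (partition_big (lcomp A r) (fun W => arc (cell A r) (lcomp A r u) W)) //=.
  apply: eq_bigr => W uW; apply: eq_bigl => w.
  apply/idP/andP => [wW|[_ /eqP<-]]; last exact: mem_comp.
  suff E : lcomp A r w = W by rewrite E eqxx.
  rewrite -(pblock_cell A_sym); apply: blockE => //.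
  by case: (arc_in (cell_acyclic_partition A_sym r) uW).
rewrite big_mkcond [RHS]big_mkcond; apply: eq_bigr => w _.
case: (posnP (A u w)) => [->|a]; first by rewrite !if_same.
congr (if _ then _ else _); apply/idP/idP => [/arc_cell_rank//|l]; first exact.
by apply/arc_cellP; exists u, w.
Qed.

(** Contraction only turns strict drops of rank into ties. An edge of the graph underlying [e] is a
    drop that is lost, so the outdegree of its upper end decreases. *)
Lemma D_contract k C e : acyclic_partition A k C -> contractible C e ->
  (D A (contract C e) <= D A C)%MM /\
  exists u, (D A (contract C e) u < D A C u)%N.
Proof.
move=> aC ce; have eC : e \in arcs C by case/andP: ce.
have [r rC] := contractible_collapses ce.
have [e1P e2P e12] := arc_ends aC eC.
have hP := acyclic_part aC.
have rr := expand_ranks aC eC rC.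
have aE := contract_acyclic_partition A_sym aC eC ce.
have rE : ranks (contract C e) r by rewrite (contract_cell A_sym aC eC rC); apply: cell_ranks.
have sub u w : (r w < r u)%N -> (2 * r w + (w \in e.1) < 2 * r u + (u \in e.1))%N.
  exact: ltn_doubleD.
split.
  apply/mnm_lepP => u; rewrite !mnmE (outdegE _ aE rE) (outdegE _ aC rr).
  rewrite big_mkcond [leqRHS]big_mkcond leq_sum //= => w _.
  by case: ifP => // /sub->.
have: arc C e.1 e.2 by rewrite /Defs.arc -surjective_pairing.
case/(arcP aC) => u [v [eu ev _ a]]; exists u.
rewrite !mnmE (outdegE _ aE rE) (outdegE _ aC rr).
rewrite big_mkcond [ltnRHS]big_mkcond (bigD1 v) //= [ltnRHS](bigD1 v) //=.
have ruv : r u = r v by case: rC => _ + _; apply.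
have ue : u \in e.1 by rewrite eu mem_block.
have ve : v \in e.1 = false.
  by rewrite eu (mem_blockE hP) -eu -ev; apply/eqP => /esym.
rewrite (_ : (r v < r u) = false) ?ruv ?ltnn // -ruv ve ue addn0 addn1 leqnn.
rewrite add0n -add1n leq_add // leq_sum // => w _.
by case: ifP => // /sub; rewrite ue addn1 => ->.
Qed.

(** Contracting the long side would place [W] both strictly below and strictly above the common rank
    of [U] and [Z]. *)
Lemma triangle_not_contractible k C U W Z : acyclic_partition A k C ->
  arc C U W -> arc C W Z -> ~~ contractible C (U, Z).
Proof.
move=> aC UW WZ; apply/negP => ce; have hP := acyclic_part aC.
have [r [r0 re r1]] := contractible_collapses ce.
have [/(part_block hP)[u _ Eu] /(part_block hP)[w _ Ew]] := arc_in aC UW.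
have [_ /(part_block hP)[z _ Ez]] := arc_in aC WZ.
have [? [? [_ _ uw _]]] := arcP aC UW.
have [? [? [_ _ wz _]]] := arcP aC WZ.
subst U W Z; have := r1 _ _ UW; have := r1 _ _ WZ; rewrite /= (re u z) //.
move=> h1 h2; have l1 : (r z < r w)%N by apply: h1 => -[/esym].
have l2 : (r w < r z)%N by apply: h2 => -[].
by rewrite ltnNge ltnW in l1.
Qed.

(** Arcs that become equal in C/e form a triangle with [e]. They cannot differ at both ends, since
    all their ends would then be ends of [e], leaving only [e] and its forbidden reversal. *)
Lemma twin_arcs k C e f h : acyclic_partition A k C ->
  e \in arcs C -> f \in arcs C -> h \in arcs C -> f != e -> h != e -> h != f ->
  induced_arc e h = induced_arc e f ->
  (h.2 = f.2 /\ [/\ h.2 <> e.1, h.2 <> e.2 &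
     h.1 = e.1 /\ f.1 = e.2 \/ h.1 = e.2 /\ f.1 = e.1]) \/
  (h.1 = f.1 /\ [/\ h.1 <> e.1, h.1 <> e.2 &
     h.2 = e.1 /\ f.2 = e.2 \/ h.2 = e.2 /\ f.2 = e.1]).
Proof.
move=> aC eC fC hC /eqP fe /eqP he /eqP hf [].
have hP := acyclic_part aC.
have [e1P e2P e12] := arc_ends aC eC.
have [f1P f2P f12] := arc_ends aC fC.
have [h1P h2P h12] := arc_ends aC hC.
have asym := arc_asym aC; rewrite /Defs.arc in asym.
case: e => e1 e2 /= in eC fe he e1P e2P e12 *.
case: f => f1 f2 /= in fC fe hf f1P f2P f12 *.
case: h => h1 h2 /= in hC he hf h1P h2P h12 *.
have nrev1 : (f1, f2) <> (e2, e1).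
  by move=> E; rewrite E in fC; have := asym _ _ fC; rewrite eC.
have nrev2 : (h1, h2) <> (e2, e1).
  by move=> E; rewrite E in hC; have := asym _ _ hC; rewrite eC.
move=> /eqP/(mergeP (e := (e1, e2)) hP e1P h1P f1P) /= H1.
move=> /eqP/(mergeP (e := (e1, e2)) hP e1P h2P f2P) /= H2.
clear -e12 fe he hf f12 h12 nrev1 nrev2 H1 H2.
case: H1 H2 => [E1|[H11 H12]] [E2|[H21 H22]].
- by case: hf; rewrite E1 E2.
- by right; split => //; split; intuition congruence.
- by left; split => //; split; intuition congruence.
- by exfalso; intuition congruence.
Qed.

(** Of two distinct arcs with the same image, one is the long side of a triangle, hence not
    contractible. *)
Lemma induced_arc_inj k C e f h : acyclic_partition A k C -> e \in arcs C ->
  f != e -> h != e -> contractible C f -> contractible C h ->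
  induced_arc e f = induced_arc e h -> f = h.
Proof.
move=> aC eC fe he cf ch E; apply/eqP/negPn/negP => fh.
have fC : f \in arcs C by case/andP: cf.
have hC : h \in arcs C by case/andP: ch.
have tri := triangle_not_contractible aC; rewrite /Defs.arc in tri.
case: (twin_arcs aC eC hC fC he fe fh E).
  case: e f h {E fe he fh} eC cf ch fC hC => e1 e2 [f1 f2] [h1 h2] /= eC cf ch fC hC.
  case=> ? [_ _ [[? ?]|[? ?]]]; subst.
    by have := tri _ _ _ eC hC; rewrite cf.
  by have := tri _ _ _ eC fC; rewrite ch.
case: e f h {E fe he fh} eC cf ch fC hC => e1 e2 [f1 f2] [h1 h2] /= eC cf ch fC hC.
case=> ? [_ _ [[? ?]|[? ?]]]; subst.
  by have := tri _ _ _ fC eC; rewrite ch.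
by have := tri _ _ _ hC eC; rewrite cf.
Qed.

(* The diamond property of contractions: merging the ends of [e] and then those  *)
(* of [g] can be done in the other order. If two arcs of [C] induce [g], they    *)
(* form a triangle with [e], and the shorter one has to be contracted first.     *)
Lemma contraction_diamond k C e g : acyclic_partition A k C ->
  contractible C e -> contractible (contract C e) g ->
  exists f, [/\ f != e, contractible C f, induced_arc e f = g,
    contractible (contract C f) (induced_arc f e) &
    contract (contract C f) (induced_arc f e) = contract (contract C e) g].
Proof.
move=> aC ce cg; have hP := acyclic_part aC.
have eC : e \in arcs C by case/andP: ce.
have gC : g \in arcs (contract C e) by case/andP: cg.
have aE := contract_acyclic_partition A_sym aC eC ce.
have [rho rhoC] := contractible_collapses cg.
have := rhoC; case=> s0 sg s1.
have [e1P e2P e12] := arc_ends aC eC.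
(* [t] measures the length of arcs; among the arcs inducing [g], the one with the smallest drop of
   [t] is chosen, which leaves only the orientations of the triangle listed in [twin]. *)
have [t tC] : exists t : part n -> nat, forall U W, arc C U W -> (t W < t U)%N.
  by case/and3P: aC => _ _ /acyclicP.
have te : (t e.2 < t e.1)%N by apply: tC; rewrite /Defs.arc -surjective_pairing.
have [f0 f0g] : exists f, [&& f \in arcs C, f != e & induced_arc e f == g].
  have /imsetP[f /setD1P[fe fC] ->] := gC.
  by exists f; rewrite fe fC eqxx.
have [f /and3P[fC fe /eqP fg] fmin] := @arg_minnP _ f0
  (fun f => [&& f \in arcs C, f != e & induced_arc e f == g])
  (fun f => t f.1 - t f.2)%N f0g.
have {f0 f0g}fmin h : h \in arcs C -> h != e -> induced_arc e h = g ->
    (t f.1 - t f.2 <= t h.1 - t h.2)%N.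
  by move=> hC he hg; apply: fmin; rewrite hC he hg eqxx.
have [f1P f2P f12] := arc_ends aC fC.
have tf : (t f.2 < t f.1)%N by apply: tC; rewrite /Defs.arc -surjective_pairing.
have bE x : pblock (parts (contract C e)) x = merge e (pblock (parts C) x).
  exact: pblock_contract aC eC x.
have bF x : pblock (parts (contract C f)) x = merge f (pblock (parts C) x).
  exact: pblock_contract aC fC x.
have r0 x y : pblock (parts C) x = pblock (parts C) y -> rho x = rho y.
  by move=> xy; apply: s0; rewrite !bE xy.
have re x y : pblock (parts C) x = e.1 -> pblock (parts C) y = e.2 -> rho x = rho y.
  by move=> xe ye; apply: s0; rewrite !bE xe ye merge1 merge2.
have rf x y : pblock (parts C) x = f.1 -> pblock (parts C) y = f.2 -> rho x = rho y.
  by move=> xe ye; apply: sg; rewrite !bE -fg ?xe ?ye.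
have twin h : h \in arcs C -> h != e -> h != f -> induced_arc e h = g ->
  (h.2 = f.2 /\ [/\ h.2 <> e.1, h.2 <> e.2, h.1 = e.1 & f.1 = e.2]) \/
  (h.1 = f.1 /\ [/\ h.1 <> e.1, h.1 <> e.2, h.2 = e.2 & f.2 = e.1]).
  move=> hC he hf hg; have th : (t h.2 < t h.1)%N.
    by apply: tC; rewrite /Defs.arc -surjective_pairing.
  have fh := fmin _ hC he hg; rewrite -fg in hg.
  case: (twin_arcs aC eC fC hC fe he hf hg) => -[E [n1 n2 [[E1 E2]|[E1 E2]]]].
  - by left; rewrite -E.
  - by move: fh th tf te; rewrite E E1 E2 leqNgt => + _ l1 l2; rewrite ltn_sub2r.
  - by move: fh th tf te; rewrite E E1 E2 leqNgt => + l1 l2 l3; rewrite ltn_sub2l.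
  - by right; rewrite -E.
have rest h x y : h \in arcs C -> h != e -> h != f ->
   h = (pblock (parts C) x, pblock (parts C) y) ->
   induced_arc e h <> g -> (rho y < rho x)%N.
  move=> hC he hf Eh hg; apply: s1; rewrite !bE; last by rewrite Eh in hg.
  by apply/imsetP; exists h; rewrite ?Eh // !inE -Eh he.
(* [rho] ties the ends of both [e] and [f]. Doubling it and adding [chi] separates the ends of [e]
   and of any twin of [f]; [chi] must agree on the ends of [f], hence the second clause when [f]
   touches [e.1]. *)
pose chi (X : part n) : bool :=
  (X == e.1) || ((f.1 == e.1) || (f.2 == e.1)) && ((X == f.1) || (X == f.2)).
have chi1 : chi e.1 by rewrite /chi eqxx.
have chi2 : chi e.2 = false.
  apply/negbTE/negP => /orP[/eqP E|/andP[/orP[]/eqP E1 /orP[]/eqP E2]].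
  - by case: e12.
  - by case: e12; rewrite -E1 -E2.
  - by case/eqP: fe; rewrite [f]surjective_pairing [e]surjective_pairing E1 E2.
  - by move: tf; rewrite -E2 E1 ltnNge ltnW.
  - by case: e12; rewrite -E1 -E2.
have cf : contractible C f.
  apply: (@collapses_contractible _ _ A_sym k _ _ aC fC
     (fun x => 2 * rho x + chi (pblock (parts C) x))%N).
  split=> [x y xy|x y xf yf|x y xy nf].
  - by rewrite (r0 x y) // xy.
  - rewrite (rf x y) // xf yf /chi !eqxx orbT andbT /=.
    by case: (f.1 == e.1) (f.2 == e.1) => -[].
  set h := (pblock (parts C) x, pblock (parts C) y) in nf xy.
  have [he|he] := eqVneq h e.
    have [xe ye] : pblock (parts C) x = e.1 /\ pblock (parts C) y = e.2 by rewrite -he.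
    by rewrite (re x y) // xe ye chi1 chi2 addn0 addn1.
  have [hg|hg] := eqVneq (induced_arc e h) g.
    rewrite (sg x y) ?bE -?hg //.
    suff [-> ->] : chi (pblock (parts C) x) /\ chi (pblock (parts C) y) = false.
      by rewrite addn0 addn1.
    case: (twin h xy he (introN eqP nf) hg) => /= -[E [n1 n2 E1 E2]].
      rewrite E1 chi1; split => //; rewrite /chi E2 -E (negPf (introN eqP n1)).
      by rewrite [e.2 == _]eq_sym (negPf (introN eqP e12)).
    by rewrite E1 chi2; split => //; rewrite /chi E E2 !eqxx !orbT.
  by apply: ltn_doubleD; apply: rest xy he (introN eqP nf) erefl (elimN eqP hg).
have mF x y : merge f (pblock (parts C) x) = merge f (pblock (parts C) y) ->
    rho x = rho y.
  move/eqP/(mergeP hP f1P (block_in hP x) (block_in hP y)).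
  case=> [/r0//|[[] Ex [] Ey]]; try (by apply: r0; rewrite Ex Ey); first exact: rf.
  by apply/esym/rf.
have eF : induced_arc f e \in arcs (contract C f).
  by apply/imsetP; exists e; rewrite // !inE eq_sym fe.
(* The same [rho] describes both double contractions, so both equal [cell A rho]. *)
have rF : collapses (contract C f) (induced_arc f e) rho.
  split=> [x y|x y|x y]; rewrite !bF; first exact: mF.
    have [x' _ Ex] := part_block hP e1P; have [y' _ Ey] := part_block hP e2P.
    rewrite /= {1}Ex {1}Ey => /mF-> /mF->; exact: re.
  case/imsetP => h /setD1P[hf hC] [hx hy] ne.
  have he : h != e by apply/eqP => E; rewrite hx hy E in ne.
  have [h1P h2P _] := arc_ends aC hC.
  have [x' _ Ex] := part_block hP h1P; have [y' _ Ey] := part_block hP h2P.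
  rewrite Ex Ey in hx hy; rewrite (mF _ _ hx) (mF _ _ hy).
  apply: (rest h) => //; first by rewrite -Ex -Ey -surjective_pairing.
  move=> hg; case: ne; rewrite hx hy -Ex -Ey /induced_arc.
  case: (twin h hC he hf hg) => -[E [_ _ E1 E2]]; rewrite E E1 -E2.
    by rewrite merge1 merge2.
  by rewrite merge1 merge2.
have aF := contract_acyclic_partition A_sym aC fC cf.
exists f; split; [exact: fe|exact: cf|exact: fg| |].
  exact: (collapses_contractible A_sym aF eF rF).
by rewrite (contract_cell A_sym aF eF rF) (contract_cell A_sym aE gC rhoC).
Qed.

End NAcyclic.

(** * The largest bounded cut and the pivot *)

Section Matching.
Variables (n : nat) (A : 'M[nat]_n.+1).
Hypothesis A_sym : forall i j, A i j = A j i.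
Variable b : 'X_{1..n.+1}.
Local Notation V := 'I_n.+1.
Implicit Types (r : V -> nat) (x y u w : V) (S T Q U W : part n) (C : pgraph n).
Implicit Types (e f g h : part n * part n) (k : nat).

Definition bounded_cut S :=
  (ord_max \notin S) && [forall u in S, \sum_(w in ~: S) A u w <= b u].

(* Bounded cuts are closed under union, so this is the largest one. *)
Definition max_cut := \bigcup_(S | bounded_cut S) S.

Lemma bounded_cutP S :
  reflect (ord_max \notin S /\ forall u, u \in S -> \sum_(w in ~: S) A u w <= b u)%N
          (bounded_cut S).
Proof.
apply: (iffP andP) => -[nS H]; split => //; last exact/forall_inP.
exact: (forall_inP H).
Qed.

Lemma sub_max_cut S : bounded_cut S -> S \subset max_cut.
Proof. by move=> bS; apply: bigcup_sup. Qed.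

Lemma max_cut_bounded : bounded_cut max_cut.
Proof.
apply/bounded_cutP; split.
  by apply/bigcupP => -[S /bounded_cutP[/negP]].
move=> u /bigcupP[S bS uS]; have /bounded_cutP[_ /(_ u uS)] := bS.
apply: leq_trans; rewrite big_mkcond [leqRHS]big_mkcond leq_sum //= => w _.
rewrite !inE; case: ifPn => // wm; rewrite ifT //; apply: contra wm.
exact: (subsetP (sub_max_cut bS)).
Qed.

Lemma max_notin_cut : ord_max \notin max_cut.
Proof. by case/bounded_cutP: max_cut_bounded. Qed.

Lemma cut_bound u : u \in max_cut -> (\sum_(w in ~: max_cut) A u w <= b u)%N.
Proof. by case/bounded_cutP: max_cut_bounded => _; apply. Qed.

(* Otherwise a component of the complement that misses [ord_max] could be added *)
(* to the cut without increasing it at any vertex.                              *)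
Lemma max_cut_compl_connected : induced_connected A (~: max_cut).
Proof.
set M := ~: max_cut.
set e := [rel x y | [&& x \in M, y \in M & (0 < A x y)%N]].
have se : connect_sym e.
  by apply: sym_connect_sym => x y /=; rewrite A_sym andbCA.
pose T := [set x | connect e ord_max x].
have TM : T \subset M.
  apply/subsetP => x; rewrite inE; elim/connect_ind => [|y z _ _ /and3P[]//].
  by rewrite inE max_notin_cut.
have : ~: T \subset max_cut.
  apply/sub_max_cut/bounded_cutP; rewrite !inE connect0; split => // u.
  rewrite !inE setCK => uT; have [uM|uM] := boolP (u \in M).
    rewrite big1 // => w wT; case: (posnP (A u w)) => // a.
    have wM := subsetP TM _ wT.
    case/negP: uT; rewrite !inE in wT *; apply: connect_trans wT (connect1 _).
    by rewrite /e /= uM wM A_sym a.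
  rewrite inE negbK in uM; apply: leq_trans (cut_bound uM).
  rewrite big_mkcond [leqRHS]big_mkcond leq_sum //= => w _.
  by case: ifP => // /(subsetP TM) ->.
rewrite -setCS setCK => MT; apply/induced_connectedP => x y /(subsetP MT) xT /(subsetP MT).
by rewrite inE; apply: connect_trans; rewrite se; rewrite inE in xT.
Qed.

(** The sink is the level of least rank, so every edge into it from outside is counted by the
    outdegree. Consequently vertices off the sink lie in [max_cut]. *)
Lemma sink_bounded k C : n_acyclic A k C -> (D A C <= b)%MM -> bounded_cut (~: sink C).
Proof.
move=> nC /mnm_lepP Db; have aC := n_acyclicW nC; have hP := acyclic_part aC.
have [r rC] := ranks_exists aC.
apply/bounded_cutP; rewrite !inE mem_block //; split => // u.
rewrite inE setCK (rank_sink _ nC rC) => us; apply: leq_trans (Db u).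
rewrite mnmE (outdegE A_sym u aC rC) big_mkcond [leqRHS]big_mkcond leq_sum //= => w _.
case: ifP => //; rewrite (rank_sink _ nC rC) => /eqP->; rewrite ifT //.
by rewrite ltn_neqAle eq_sym us (rank_max _ nC rC).
Qed.

(* A connected set where [r] has a local minimum relative to [max_cut]. *)
Definition basin r Q :=
  [&& Q != set0, Q \subset max_cut, induced_connected A Q
    & [forall u in Q, forall w in max_cut, (0 < A u w)%N ==>
        if w \in Q then r u == r w else (r u < r w)%N]].

Lemma basinP r Q :
  reflect [/\ Q != set0, Q \subset max_cut, induced_connected A Q,
     {in Q &, forall u w, (0 < A u w)%N -> r u = r w} &
     forall u w, u \in Q -> w \in max_cut -> w \notin Q -> (0 < A u w)%N -> (r u < r w)%N]
   (basin r Q).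
Proof.
apply: (iffP and4P) => [[Q0 Qm Qc /forall_inP H]|[Q0 Qm Qc H1 H2]]; split => //.
- move=> u w uQ wQ a; have /forall_inP/(_ w (subsetP Qm _ wQ)) := H u uQ.
  by rewrite a wQ => /eqP.
- move=> u w uQ wm wQ a; have /forall_inP/(_ w wm) := H u uQ.
  by rewrite a (negPf wQ).
apply/forall_inP => u uQ; apply/forall_inP => w wm; apply/implyP => a.
by case: ifPn => wQ; [apply/eqP/H1|apply: H2].
Qed.

Lemma basin_const r Q x y : basin r Q -> x \in Q -> y \in Q -> r x = r y.
Proof.
case/basinP => _ _ /induced_connectedP Qc H _ xQ yQ.
have := Qc x y xQ yQ; elim/connect_ind => // s t _ -> /and3P[sQ tQ a].
exact: H.
Qed.

(** Within [max_cut], the level component of a vertex of [T] of least rank cannot leave [T], and its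
    neighbours in the cut lie strictly higher. *)
Lemma basin_exists r T : T != set0 -> T \subset max_cut ->
  (forall u w, u \in T -> w \in max_cut -> w \notin T -> (0 < A u w)%N -> (r u < r w)%N) ->
  exists2 Q, basin r Q & Q \subset T.
Proof.
case/set0Pn => v0 v0T Tm H; have [v vT vmin] := arg_minnP r v0T.
pose e := [rel x y | [&& x \in max_cut, y \in max_cut, 0 < A x y & r x == r y]%N].
pose Q := [set x | connect e v x].
have QT : Q \subset T.
  apply/subsetP => x; rewrite inE; elim/connect_ind => // s t _ sT /and4P[sm tm a rst].
  by apply: contraT => tT; have := H _ _ sT tm tT a; rewrite (eqP rst) ltnn.
have rQ x : x \in Q -> r x = r v.
  by rewrite inE; elim/connect_ind => // s t _ <- /and4P[_ _ _ /eqP].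
have Qm := subset_trans QT Tm.
exists Q => //; apply/basinP; split => //.
- by apply/set0Pn; exists v; rewrite inE connect0.
- pose eQ := [rel x y | [&& x \in Q, y \in Q & (0 < A x y)%N]].
  have se : connect_sym eQ by apply: sym_connect_sym => x y /=; rewrite A_sym andbCA.
  suff vQ x : x \in Q -> connect eQ v x.
    apply/induced_connectedP => x y /vQ vx /vQ; apply: connect_trans.
    by rewrite -/eQ se.
  rewrite inE; elim/connect_ind => [|s t vs IH st]; first exact: connect0.
  apply: connect_trans IH (connect1 _).
  rewrite /eQ /= !inE vs (connect_trans vs (connect1 st)) /=.
  by case/and4P: st.
- by move=> u w uQ wQ _; rewrite !rQ.
move=> u w uQ wm wQ a; have uT := subsetP QT _ uQ.
have [wT|] := boolP (w \in T); last by move=> wT; apply: H.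
rewrite ltn_neqAle (rQ u) // vmin // andbT; apply: contra wQ => /eqP vw.
have ru := rQ u uQ; move: uQ; rewrite !inE => uQ; apply: connect_trans uQ (connect1 _) => /=.
by rewrite wm a (subsetP Tm) //= ru vw.
Qed.

(** A path in [Q] leaving [Q'] would have to climb, whereas ranks are constant on [Q]. So basins
    sharing a vertex coincide, and the key, a vertex of the basin, tells basins apart. *)
Lemma basin_meet r Q Q' x : basin r Q -> basin r Q' -> x \in Q -> x \in Q' -> Q \subset Q'.
Proof.
move=> /basinP[_ Qm Qc H _] /basinP[_ _ _ _ H'] xQ xQ'; apply/subsetP => y yQ.
have := induced_connectedP _ _ Qc x y xQ yQ.
elim/connect_ind => // s t _ sQ' /and3P[sQ tQ a]; apply: contraT => tQ'.
by have := H' s t sQ' (subsetP Qm _ tQ) tQ' a; rewrite (H s t) ?ltnn.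
Qed.

Definition key Q := (\max_(i in Q) i)%N.

(* Using the largest vertices as keys makes [key] monotone, so that coarsening *)
(* [r] cannot decrease the minimal key (see [pivot_coarsen]).                  *)
Definition pivot r Q := basin r Q && [forall Q', basin r Q' ==> (key Q <= key Q')%N].

Lemma pivotP r Q :
  reflect (basin r Q /\ forall Q', basin r Q' -> (key Q <= key Q')%N) (pivot r Q).
Proof.
apply: (iffP andP) => -[bQ H]; split=> //; last first.
  by apply/forallP => Q'; apply/implyP/H.
by move=> Q' bQ'; move/forallP/(_ Q'): H; rewrite bQ'.
Qed.

Lemma key_sub Q Q' : Q \subset Q' -> (key Q <= key Q')%N.
Proof.
move=> QQ'; apply/bigmax_leqP => i iQ.
by rewrite [leqRHS](bigD1 i) ?(subsetP QQ') //= leq_maxl.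
Qed.

Lemma key_in Q : Q != set0 -> exists2 i : V, i \in Q & key Q = i.
Proof.
rewrite -card_gt0 => Q0.
by have [i iQ E] := eq_bigmax_cond (fun i : V => i : nat) Q0; exists i.
Qed.

Lemma pivot_unique r Q Q' : pivot r Q -> pivot r Q' -> Q = Q'.
Proof.
move=> /pivotP[bQ mQ] /pivotP[bQ' mQ'].
have /basinP[/key_in[i iQ Ei] _ _ _ _] := bQ.
have /basinP[/key_in[j jQ' Ej] _ _ _ _] := bQ'.
have ij : i = j by apply/val_inj; rewrite /= -Ei -Ej; apply/eqP; rewrite eqn_leq mQ // mQ'.
subst j; apply/eqP; rewrite eqEsubset (basin_meet bQ bQ' iQ jQ') //.
exact: basin_meet bQ' bQ jQ' iQ.
Qed.

Lemma pivot_exists r : max_cut != set0 -> exists Q, pivot r Q.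
Proof.
move=> m0; have [|Q0 bQ0 _] := @basin_exists r max_cut m0 (subxx _).
  by move=> u w _ ->.
have [Q bQ mQ] := arg_minnP key bQ0.
by exists Q; apply/pivotP.
Qed.

(** A basin for [r'] need not be one for [r], but by [basin_exists] it contains one, whose key is
    not larger. *)
Lemma pivot_coarsen r r' Q : pivot r Q -> basin r' Q ->
  (forall u w, (0 < A u w)%N -> (r' w < r' u)%N -> (r w < r u)%N) -> pivot r' Q.
Proof.
move=> /pivotP[_ mQ] bQ H; apply/pivotP; split => // Q' /basinP[Q0 Qm _ _ HQ'].
have [|Q'' bQ'' sub] := @basin_exists r Q' Q0 Qm.
  by move=> u w uQ wm wQ a; apply: H; rewrite 1?A_sym //; apply: HQ'.
exact: leq_trans (mQ _ bQ'') (key_sub sub).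
Qed.

(** The pivot depends only on comparisons along edges, hence on the cell and not on the rank
    function chosen for it. *)
Lemma pivot_edge r r' Q :
  (forall u w, (0 < A u w)%N -> (r w < r u)%N = (r' w < r' u)%N) ->
  pivot r Q -> pivot r' Q.
Proof.
move=> H pQ; apply: pivot_coarsen (pQ) _ _ => [|u w a]; last by rewrite (H u w a).
have /pivotP[/basinP[Q0 Qm Qc H1 H2] _] := pQ; apply/basinP; split => //.
  move=> u w uQ wQ a; have E := H1 u w uQ wQ a.
  have := H u w a; have := H w u; rewrite A_sym a E ltnn => /(_ isT).
  by case: ltngtP.
by move=> u w uQ wm wQ a; rewrite -H ?H2 // A_sym.
Qed.

End Matching.

(** * The matching of bounded cells *)

Section Partners.
Variables (n : nat) (A : 'M[nat]_n.+1).
Hypothesis A_sym : forall i j, A i j = A j i.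
Variable b : 'X_{1..n.+1}.
Local Notation V := 'I_n.+1.
Local Notation blk C := (pblock (parts C)).
Implicit Types (r : V -> nat) (x y u w : V) (S T Q U W : part n) (C : pgraph n).
Implicit Types (e f g h : part n * part n) (k : nat).

Lemma ranks_edge k C r u w : acyclic_partition A k C -> ranks C r -> (0 < A u w)%N ->
  arc C (blk C u) (blk C w) = (r w < r u)%N.
Proof.
move=> aC rC a; rewrite (cell_of_ranks aC rC) !(pblock_cell A_sym).
by apply/idP/idP => [/(arc_cell_rank A_sym)//|l]; apply/arc_cellP; exists u, w.
Qed.

Lemma ranks_block k C r u w : acyclic_partition A k C -> ranks C r -> (0 < A u w)%N ->
  r u = r w -> blk C u = blk C w.
Proof.
move=> aC rC a E; rewrite (cell_of_ranks aC rC) !(pblock_cell A_sym).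
exact: comp_level.
Qed.

(** A canonical rank function, so that [lower] and [raises] are determined by the cell. *)
Definition crank C x := #|[set Z | connect (arc C) (blk C x) Z]|.

Lemma crank_ranks k C : acyclic_partition A k C -> ranks C (crank C).
Proof.
case/and3P=> _ _ aC; split=> [x y E|x y xy]; first by rewrite /crank E.
apply: proper_card; apply/properP; split.
  by apply/subsetP => Z; rewrite !inE; apply: connect_trans (connect1 xy).
exists (blk C x); rewrite inE ?connect0 //.
by move/forallP: aC => /(_ (blk C x))/forallP/(_ (blk C y)); rewrite xy.
Qed.

Definition bounded_cell k C := n_acyclic A k C && (D A C <= b)%MM.

(* The sink contains the complement of [max_cut]. The cell is lower if it has *)
(* absorbed the pivot, and otherwise the pivot is a part.                     *)
Definition lower C := [exists Q, pivot A b (crank C) Q && (Q \subset sink C)].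

Lemma lowerP k C r : acyclic_partition A k C -> ranks C r ->
  reflect (exists2 Q, pivot A b r Q & Q \subset sink C) (lower C).
Proof.
move=> aC rC; have cC := crank_ranks aC.
have E u w : (0 < A u w)%N -> (crank C w < crank C u)%N = (r w < r u)%N.
  by move=> a; rewrite -(ranks_edge aC cC a) (ranks_edge aC rC a).
apply: (iffP existsP) => [[Q /andP[pQ sQ]]|[Q pQ sQ]]; exists Q => //.
  exact: pivot_edge pQ.
by rewrite sQ andbT; apply: pivot_edge pQ => // u w a; rewrite E.
Qed.

Lemma collapse_coarse k C e r r' u w : acyclic_partition A k C -> e \in arcs C ->
  ranks C r -> collapses C e r' -> (0 < A u w)%N -> (r' w < r' u)%N -> (r w < r u)%N.
Proof.
move=> aC eC [_ r1] [s0 se s1] a l.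
have ne : blk C u <> blk C w by move/s0 => E; rewrite E ltnn in l.
case: (edge_arc aC a ne) => [/r1//|wu].
have [E|/eqP E] := eqVneq (blk C w, blk C u) e; last first.
  by have := s1 _ _ wu E; rewrite ltnNge ltnW.
by rewrite (se w u) ?ltnn // -E in l.
Qed.

(** Lifts [Q] by half a step: above its old level and below the next one. *)
Definition raise_rank r Q x := (2 * r x + (x \in Q))%N.

Section Pivot.
Variables (k : nat) (C : pgraph n) (r : V -> nat) (Q : part n).
Hypotheses (bC : bounded_cell k C) (rC : ranks C r) (pQ : pivot A b r Q).

Let nC : n_acyclic A k C. Proof. by case/andP: bC. Qed.
Let aC := n_acyclicW nC.
Let hP := acyclic_part aC.
Let bQ : basin A b r Q. Proof. by case/pivotP: pQ. Qed.
Let rE x := rank_sink x nC rC.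

Lemma off_sink_cut x : x \notin sink C -> x \in max_cut A b.
Proof.
have bs : bounded_cut A b (~: sink C).
  by case/andP: bC => nC' Db; apply: (sink_bounded A_sym nC' Db).
by move=> xs; apply: (subsetP (sub_max_cut bs)); rewrite inE.
Qed.

(** Ranks are constant on [Q] and the sink is a full level, so meeting it means lying in it. Off the
    sink, the block around [Q] lies in [max_cut], where it could leave [Q] only by climbing. *)
Lemma pivot_dichotomy : Q \subset sink C \/ Q \in parts C /\ Q <> sink C.
Proof.
have /basinP[/set0Pn[x xQ] Qm Qc H1 H2] := bQ.
have [xs|xs] := boolP (x \in sink C).
  by left; apply/subsetP => y yQ; rewrite rE -(basin_const bQ xQ yQ) -rE.
right; suff E : Q = blk C x.
  split; first by rewrite E block_in.
  by move=> E'; rewrite E' in xQ; rewrite xQ in xs.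
apply/eqP; rewrite eqEsubset; apply/andP; split; apply/subsetP => y.
  move=> yQ; have := induced_connectedP _ _ Qc x y xQ yQ; rewrite (mem_blockE hP).
  elim/connect_ind => [|s t _ /eqP<- /and3P[sQ tQ a]]; first exact: eqxx.
  by rewrite eq_sym; apply/eqP/(ranks_block aC rC a)/H1.
have /induced_connectedP Bc := part_connected aC (block_in hP x).
move=> yx; have := Bc x y (mem_block hP x) yx.
elim/connect_ind => // s t _ sQ /and3P[sx tx a]; apply: contraT => tQ.
have ts : t \in max_cut A b.
  apply: off_sink_cut; apply: contra xs; rewrite !(mem_blockE hP) in tx *.
  by rewrite (eqP tx).
have := H2 s t sQ ts tQ a; rewrite (rC.1 s t) ?ltnn //.
by rewrite !(mem_blockE hP) in sx tx; rewrite (eqP sx) (eqP tx).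
Qed.

(** * Upper cells: absorbing the pivot into the sink *)

Section Upper.
Hypotheses (QP : Q \in parts C) (Qs : Q <> sink C).

Let blkQ x : x \in Q -> blk C x = Q. Proof. exact: blockE. Qed.
Let Qblk x : blk C x = Q -> x \in Q. Proof. by move<-; apply: mem_block. Qed.
Let QsF x : x \in Q -> x \in sink C = false.
Proof.
by move=> xQ; apply/negP => xs; apply: Qs; rewrite -(blkQ xQ) (blockE hP _ xs) ?block_in.
Qed.

(** Within [max_cut] every edge leaving [Q] goes up, and all vertices off the sink are in
    [max_cut]. *)
Lemma arc_pivot W : arc C Q W -> W = sink C.
Proof.
move=> QW; have [x [y [Ex Ey _ a]]] := arcP aC QW.
rewrite Ey; have xQ := Qblk (esym Ex).
rewrite Ex Ey (ranks_edge aC rC a) in QW.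
have yQ : y \notin Q.
  apply/negP => yQ; move: QW; rewrite (basin_const bQ xQ yQ) ltnn //.
have [ys|/off_sink_cut ym] := boolP (y \in sink C); first exact/(blockE hP)/ys/block_in.
have /basinP[_ _ _ _ H2] := bQ.
by have := H2 x y xQ ym yQ a; rewrite ltnNge ltnW.
Qed.

Lemma pivot_arc : (Q, sink C) \in arcs C.
Proof.
have [x xQ Ex] := part_block hP QP.
have [_ oC] := (n_acyclicP _ _ _).1 nC.
have nx : ord_max \notin blk C x.
  by rewrite -Ex; apply/negP => /blkQ E; apply: Qs.
by have [W] := oC x nx; rewrite -Ex => QW; rewrite -(arc_pivot QW).
Qed.

Definition lower_rank x := if x \in Q then r ord_max else r x.

Lemma lower_rank_collapses : collapses C (Q, sink C) lower_rank.
Proof.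
have mQ x y : blk C x = blk C y -> (x \in Q) = (y \in Q).
  by move=> E; apply/idP/idP => /blkQ E'; apply: Qblk; rewrite -E'.
split=> [x y xy|x y /= /Qblk xQ ys|x y xy ne]; rewrite /lower_rank.
- by rewrite (mQ x y xy) (rC.1 x y xy).
- have ys' : y \in sink C by rewrite -ys mem_block.
  rewrite xQ ifF; first by apply/esym/eqP; rewrite -rE.
  by apply/negP => /QsF; rewrite ys'.
have l := rC.2 _ _ xy.
case: ifPn => yQ; case: ifPn => xQ.
- by move: l; rewrite (basin_const bQ xQ yQ) ltnn.
- exact: leq_ltn_trans (rank_max y nC rC) l.
- by case: ne; rewrite (blkQ xQ) in xy *; rewrite (arc_pivot xy).
- exact: l.
Qed.

Lemma pivot_contractible : contractible C (Q, sink C).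
Proof. exact: (collapses_contractible A_sym aC pivot_arc lower_rank_collapses). Qed.

Let aE := contract_acyclic_partition A_sym aC pivot_arc pivot_contractible.

(** Sinking [Q] to the least rank keeps it below its neighbours in the cut, and contraction coarsens
    the ranks, so [pivot_coarsen] applies. *)
Lemma contract_pivot r' : ranks (contract C (Q, sink C)) r' -> pivot A b r' Q.
Proof.
set e := (Q, sink C) => rE'.
have eC : e \in arcs C := pivot_arc.
have rkE : ranks (contract C e) lower_rank.
  by rewrite (contract_cell A_sym aC eC lower_rank_collapses); apply: cell_ranks.
suff pE : pivot A b lower_rank Q.
  apply: pivot_edge pE => // u w a.
  by rewrite -(ranks_edge aE rE' a) (ranks_edge aE rkE a).
apply: pivot_coarsen pQ _ _ => // [|u w]; last first.
  exact: collapse_coarse aC eC rC lower_rank_collapses.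
have /basinP[Q0 Qm Qc H1 H2] := bQ; apply/basinP; split => // [u w uQ wQ _|u w uQ wm wQ a].
  by rewrite /lower_rank uQ wQ.
rewrite /lower_rank uQ (negPf wQ).
by apply: leq_ltn_trans (rank_max u nC rC) _; apply: H2.
Qed.

Lemma contract_pivot_lower : lower (contract C (Q, sink C)).
Proof.
have [r' rE'] := ranks_exists aE.
apply/(lowerP aE rE'); exists Q; first exact: contract_pivot.
rewrite /sink (pblock_contract aC pivot_arc) -/(sink C) (merge2 (Q, sink C)) /=.
exact: subsetUl.
Qed.

Lemma pivot_not_lower : ~~ lower C.
Proof.
apply/(lowerP aC rC) => -[Q' pQ']; rewrite (pivot_unique pQ' pQ).
have /basinP[/set0Pn[x xQ] _ _ _ _] := bQ.
by move/subsetP/(_ x xQ); rewrite QsF.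
Qed.

(** If [f] does not end in the sink, the sink is unchanged and lacks [Q]. If [f] absorbs another
    part into the sink, [Q] is still the pivot and still outside the sink, so C/f is not lower. *)
Lemma lower_contract_sink f : contractible C f -> f != (Q, sink C) ->
  lower (contract C f) ->
  (#|sink (contract C f)| < #|sink (contract C (Q, sink C))|)%N.
Proof.
move=> cf fe; have fC : f \in arcs C by case/andP: cf.
have [f1P f2P f12] := arc_ends aC fC.
have f1s : sink C != f.1.
  apply/eqP => E; have := sink_no_arc f.2 nC.
  by rewrite E /Defs.arc -surjective_pairing fC.
have sE : sink (contract C (Q, sink C)) = Q :|: sink C.
  by rewrite -(merge2 (Q, sink C)); apply: (pblock_contract aC pivot_arc).
have sf : sink (contract C f) = merge f (sink C) by apply: (pblock_contract aC fC).
rewrite sE sf.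
have [f2s lf|f2s _] := eqVneq (sink C) f.2; last first.
  rewrite (merge_id f1s f2s); apply: proper_card; apply/properP; split; first exact: subsetUr.
  have /basinP[/set0Pn[x xQ] _ _ _ _] := bQ.
  by exists x; rewrite ?inE ?xQ ?QsF.
exfalso; have [s sC] := contractible_collapses cf.
have aF := contract_acyclic_partition A_sym aC fC cf.
have sF : ranks (contract C f) s.
  by rewrite (contract_cell A_sym aC fC sC); apply: cell_ranks.
have f1Q : f.1 <> Q.
  by move=> E; case/eqP: fe; rewrite [f]surjective_pairing E f2s.
have /basinP[Q0 Qm Qc H1 H2] := bQ.
have [s0 se s1] := sC.
have ps : pivot A b s Q.
  apply: pivot_coarsen pQ _ _ => // [|u w]; last exact: collapse_coarse aC fC rC sC.
  apply/basinP; split => // [u w uQ wQ _|u w uQ wm wQ a].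
    by apply: s0; rewrite !blkQ.
  have l := H2 u w uQ wm wQ a; rewrite A_sym in a.
  rewrite -(ranks_edge aC rC a) in l; apply: s1 => // E.
  by apply: Qs; rewrite f2s -E /= blkQ.
case/(lowerP aF sF): lf => Q' pQ'; rewrite (pivot_unique pQ' ps).
case/set0Pn: Q0 => x xQ /subsetP/(_ x xQ).
rewrite sf f2s merge2 inE -f2s QsF // orbF => xf.
by apply: f1Q; rewrite -(blockE hP f1P xf) blkQ.
Qed.

Lemma expand_contract r' : ranks (contract C (Q, sink C)) r' ->
  C = cell A (raise_rank r' Q).
Proof.
case=> s0 s1; have eC := pivot_arc; apply/(cell_of_ranks aC).
have bE x : blk (contract C (Q, sink C)) x = merge (Q, sink C) (blk C x).
  exact: pblock_contract aC eC x.
apply: (expand_ranks aC eC); split=> [x y xy|x y /= xQ ys|x y xy /eqP ne].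
- by apply: s0; rewrite !bE xy.
- by apply: s0; rewrite !bE xQ ys (merge1 (Q, _)) (merge2 (Q, _)).
- apply: s1; rewrite !bE; apply/imsetP; exists (blk C x, blk C y) => //.
  by rewrite !inE ne.
Qed.

End Upper.

(** * Lower cells: releasing the pivot from the sink *)

Section Lower.
Hypothesis Qs : Q \subset sink C.

Let nQ : ord_max \notin Q.
Proof.
have /basinP[_ Qm _ _ _] := bQ.
by apply/negP => /(subsetP Qm); rewrite (negPf (max_notin_cut A b)).
Qed.

Let CE : C = cell A r. Proof. exact: (cell_of_ranks aC rC). Qed.

Let rQ x : x \in Q -> r x = r ord_max.
Proof. by move=> /(subsetP Qs); rewrite rE => /eqP. Qed.

Let leave_cut x y : x \in Q -> y \in sink C :\: Q -> (0 < A x y)%N -> y \notin max_cut A b.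
Proof.
move=> xQ /setDP[ys yQ] a; apply/negP => ym; have /basinP[_ _ _ _ H2] := bQ.
have := H2 x y xQ ym yQ a; rewrite (rQ xQ).
by move: ys; rewrite rE => /eqP->; rewrite ltnn.
Qed.

(* A path inside the sink that leaves [Q] enters the complement of [max_cut], *)
(* which is connected and avoids [Q].                                         *)
Lemma sink_minus_connected : induced_connected A (sink C :\: Q).
Proof.
set T := sink C :\: Q.
pose eT := [rel x y | [&& x \in T, y \in T & (0 < A x y)%N]].
have se : connect_sym eT by apply: sym_connect_sym => x y /=; rewrite A_sym andbCA.
have Qm : Q \subset max_cut A b by case/basinP: bQ.
have cT x : x \notin max_cut A b -> x \in T.
  move=> xm; rewrite inE (contra (subsetP Qm x) xm) /=.
  by apply: contraR xm; apply: off_sink_cut.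
suff nT x : x \in T -> connect eT ord_max x.
  apply/induced_connectedP => x y /nT nx /nT; apply: connect_trans.
  by rewrite -/eT se.
move=> xT; have /setDP[xs _] := xT.
have ns : ord_max \in sink C by apply: mem_block.
have /induced_connectedP Sc := part_connected aC (block_in hP ord_max).
suff: x \in Q \/ connect eT ord_max x by case/setDP: xT => _ /negPf->; case.
have := Sc _ _ ns xs; elim/connect_ind => [|s t _ IH /and3P[ss ts a]].
  by right; apply: connect0.
have [tQ|tQ] := boolP (t \in Q); first by left.
right; have tT : t \in T by rewrite inE tQ.
have [tm|tm] := boolP (t \in max_cut A b); last first.
  have := induced_connectedP _ _ (max_cut_compl_connected A_sym b) ord_max t.
  rewrite !inE max_notin_cut tm => /(_ isT isT); apply: connect_sub => y z /and3P[].
  by rewrite !inE => /cT yT /cT zT a'; rewrite connect1 // /eT /= yT zT.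
case: IH => [sQ|ns']; first by case/negP: (leave_cut sQ tT a).
apply: connect_trans ns' (connect1 _); rewrite /eT /= tT a andbT andbT inE ss andbT.
by apply/negP => sQ; case/negP: (leave_cut sQ tT a).
Qed.

(** The connected sink contains [ord_max], which is not in [Q]. The edge found here becomes an
    outgoing arc of the released part. *)
Lemma pivot_sink_edge : exists x y, [/\ x \in Q, y \in sink C :\: Q & (0 < A x y)%N].
Proof.
have /basinP[/set0Pn[x xQ] _ _ _ _] := bQ.
have ns : ord_max \in sink C by apply: mem_block.
have /induced_connectedP Sc := part_connected aC (block_in hP ord_max).
have := Sc _ _ (subsetP Qs _ xQ) ns.
suff H z : connect [rel s t | [&& s \in sink C, t \in sink C & (0 < A s t)%N]] x z ->
    z \in Q \/ exists x y, [/\ x \in Q, y \in sink C :\: Q & (0 < A x y)%N].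
  by case/H => //; rewrite (negPf nQ).
elim/connect_ind => [|s t _ [sQ|H] /and3P[_ ts a]]; [by left| |by right].
have [tQ|tQ] := boolP (t \in Q); first by left.
by right; exists s, t; rewrite inE tQ.
Qed.


Local Notation raise_rank := (raise_rank r Q).

Let raise_eq x y : raise_rank x = raise_rank y -> r x = r y /\ (x \in Q) = (y \in Q).
Proof. by rewrite /raise_rank; case: (x \in Q); case: (y \in Q) => /= E; split=> //; move: E; clear; lia. Qed.

Let raise_lt x y : (r x < r y)%N -> (raise_rank x < raise_rank y)%N.
Proof. exact: ltn_doubleD. Qed.

Lemma lcomp_raise_pivot x : x \in Q -> lcomp A raise_rank x = Q.
Proof.
move=> xQ; have /basinP[_ _ Qc _ _] := bQ; apply/setP => y; apply/idP/idP.
  by move/rank_comp/raise_eq => [_ ->].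
move=> yQ; have := induced_connectedP _ _ Qc x y xQ yQ; rewrite inE.
apply: connect_sub => s t /and3P[sQ tQ a].
by rewrite connect1 // levelE a /raise_rank sQ tQ !rQ /=.
Qed.

Lemma lcomp_raise_sink x : x \in sink C :\: Q -> lcomp A raise_rank x = sink C :\: Q.
Proof.
move=> xT; have := xT; rewrite inE rE => /andP[xQ /eqP xn].
apply/setP => y; apply/idP/idP.
  by move/rank_comp/raise_eq => [E EQ]; rewrite inE rE E EQ xQ xn eqxx.
move=> yT; have := induced_connectedP _ _ sink_minus_connected x y xT yT; rewrite inE.
apply: connect_sub => s t /and3P[]; rewrite !inE !rE.
move=> /andP[sQ /eqP sn] /andP[tQ /eqP tn] a.
by rewrite connect1 // levelE a /raise_rank (negPf sQ) (negPf tQ) sn tn /=.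
Qed.

Lemma lcomp_raise_off x : x \notin sink C -> lcomp A raise_rank x = blk C x.
Proof.
move=> xs; rewrite [in RHS]CE (pblock_cell A_sym); apply/setP => y; rewrite [RHS]inE.
apply/idP/idP; first rewrite inE.
  apply: connect_sub => s t; rewrite levelE => /andP[a /eqP/raise_eq[st _]].
  by rewrite connect1 // levelE a st /=.
suff H : connect (level A r) x y -> y \in lcomp A raise_rank x /\ r y = r x by case/H.
elim/connect_ind => [|s t _ [sx Es]]; first by rewrite mem_comp.
rewrite levelE => /andP[a /eqP st]; rewrite -st Es; split => //.
have off z : r z = r x -> z \in Q = false.
  move=> zx; apply: contraNF xs => /rQ zn.
  by rewrite rE -zx zn.
move: sx; rewrite !inE => sx; apply: connect_trans sx (connect1 _).
by rewrite levelE a /raise_rank !off -?st //= eqxx.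
Qed.

Let C' := cell A raise_rank.
Let nT : ord_max \in sink C :\: Q. Proof. by rewrite inE nQ; apply: mem_block. Qed.

Lemma sink_raise : sink C' = sink C :\: Q.
Proof. by rewrite /sink (pblock_cell A_sym) lcomp_raise_sink. Qed.

Lemma raise_n_acyclic : n_acyclic A #|parts C'| C'.
Proof.
apply/n_acyclicP; split; first exact: cell_acyclic_partition.
move=> x; rewrite (pblock_cell A_sym) => nx.
have [xs|xs] := boolP (x \in sink C).
  have [xQ|xQ] := boolP (x \in Q); last first.
    by rewrite lcomp_raise_sink ?nT // inE xQ in nx.
  have [s [t [sQ tT a]]] := pivot_sink_edge.
  exists (lcomp A raise_rank t); apply/arc_cellP; exists s, t; split => //.
    by rewrite !lcomp_raise_pivot.
  case/setDP: tT => ts tQ; rewrite rE in ts.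
  by rewrite /raise_rank sQ (negPf tQ) (eqP ts) (rQ sQ) addn0 addn1.
rewrite lcomp_raise_off // in nx *.
have [_ /(_ x nx)[W]] := (n_acyclicP _ _ _).1 nC.
move=> xW; have [s [t [Es Et _ a]]] := arcP aC xW.
exists (lcomp A raise_rank t); apply/arc_cellP; exists s, t; split => //.
  rewrite lcomp_raise_off //; apply: contra xs.
  by rewrite !(mem_blockE hP) Es.
by apply: raise_lt; rewrite -(ranks_edge aC rC a) -Es -Et.
Qed.

(** A vertex of [Q] now drops only to vertices outside [max_cut], so its outdegree is at most its
    cut, which is bounded by [b]. For any other vertex no new drop appears. *)
Lemma raise_bounded : bounded_cell #|parts C'| C'.
Proof.
rewrite /bounded_cell raise_n_acyclic /=; case/andP: bC => _ /mnm_lepP Db.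
apply/mnm_lepP => u; rewrite mnmE.
rewrite (outdegE A_sym u (n_acyclicW raise_n_acyclic) (cell_ranks A_sym _)).
have /basinP[_ Qm _ H1 H2] := bQ.
have [uQ|uQ] := boolP (u \in Q).
  apply: leq_trans (cut_bound (subsetP Qm u uQ)).
  rewrite big_mkcond [leqRHS]big_mkcond leq_sum //= => w _.
  case: ifP => // l; case: (posnP (A u w)) => [->|a]; first by case: ifP.
  rewrite ifT // inE; apply/negP => wm; move: l.
  have [wQ|wQ] := boolP (w \in Q); first by rewrite /raise_rank uQ wQ (H1 u w) // ltnn.
  by rewrite ltnNge ltnW ?raise_lt ?H2.
apply: leq_trans (Db u); rewrite mnmE (outdegE A_sym u aC rC).
rewrite big_mkcond [leqRHS]big_mkcond leq_sum //= => w _.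
case: ifP => //; rewrite /raise_rank (negPf uQ) => l; rewrite ifT //.
by move: l; case: (w \in Q) => /=; clear; lia.
Qed.

(** Raising creates no basin: if an edge leaving a new basin [Q'] climbed only because its end in
    [Q] was raised from a tie, the basin property of [Q] would exclude that tie. *)
Lemma raise_pivot : pivot A b raise_rank Q.
Proof.
have /basinP[Q0 Qm Qc H1 H2] := bQ; have /pivotP[_ mQ] := pQ.
apply/pivotP; split.
  apply/basinP; split => // [u w uQ wQ a|u w uQ wm wQ a].
    by rewrite /raise_rank uQ wQ (H1 u w).
  exact/raise_lt/H2.
move=> Q' /basinP[Q0' Qm' Qc' H1' H2']; apply: mQ; apply/basinP; split => //.
  by move=> u w uQ wQ a; case: (raise_eq (H1' u w uQ wQ a)).
move=> u w uQ' wm wQ' a; have l := H2' u w uQ' wm wQ' a.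
case: (ltngtP (r u) (r w)) (l) => [//|/raise_lt gt|E]; first by rewrite ltnNge (ltnW gt).
rewrite /raise_rank E ltn_add2l.
case: (boolP (u \in Q)) => uQ; case: (boolP (w \in Q)) => // wQ.
by rewrite A_sym in a; have := H2 w u wQ (subsetP Qm' _ uQ') uQ a; rewrite E ltnn.
Qed.

(** The only ties of [r] along edges that raising breaks are those between [Q] and the rest of the
    sink. *)
Lemma raise_collapses : collapses C' (Q, sink C') r.
Proof.
rewrite sink_raise; split=> [x y|x y /= xQ yT|x y].
- by rewrite !(pblock_cell A_sym) => /comp_rank/raise_eq[].
- have xQ' : x \in Q by rewrite -xQ (pblock_cell A_sym) mem_comp.
  have : y \in sink C :\: Q by rewrite -yT (pblock_cell A_sym) mem_comp.
  by rewrite inE rE => /andP[_ /eqP->]; apply: rQ.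
rewrite !(pblock_cell A_sym) => /arc_cellP[s [t [Es Et a l]]].
have [-> _] := raise_eq (comp_rank A_sym Es); have [-> _] := raise_eq (comp_rank A_sym Et).
rewrite Es Et => ne; case: (ltngtP (r t) (r s)) (l) => [//|/raise_lt gt|E].
  by rewrite ltnNge (ltnW gt).
rewrite /raise_rank E ltn_add2l.
case: (boolP (s \in Q)) => sQ; case: (boolP (t \in Q)) => // tQ.
by case: ne; rewrite lcomp_raise_pivot // lcomp_raise_sink // inE tQ rE E rQ ?eqxx.
Qed.

Lemma raise_part : Q \in parts C' /\ Q <> sink C'.
Proof.
have /basinP[/set0Pn[x xQ] _ _ _ _] := bQ; split.
  by apply/imsetP; exists x; rewrite ?lcomp_raise_pivot.
by rewrite sink_raise => E; have := xQ; rewrite {1}E inE xQ.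
Qed.

End Lower.

End Pivot.

Lemma lower_partner k C : bounded_cell k C -> lower C ->
  exists C' e, [/\ bounded_cell k.+1 C', ~~ lower C', contractible C' e,
    contract C' e = C & forall f, contractible C' f -> f != e -> lower (contract C' f) ->
      (#|sink (contract C' f)| < #|sink C|)%N].
Proof.
move=> bC lC; have aC : acyclic_partition A k C by case/andP: bC => /n_acyclicW.
have [r rC] := ranks_exists aC.
have /(lowerP aC rC)[Q pQ Qs] := lC.
set C' := cell A (raise_rank r Q); pose e := (Q, sink C').
have bC' : bounded_cell #|parts C'| C' := raise_bounded bC rC pQ Qs.
have rC' : ranks C' (raise_rank r Q) := cell_ranks A_sym _.
have pQ' := raise_pivot pQ.
have [QP QN] := raise_part bC rC pQ Qs.
have cC' := pivot_contractible bC' rC' pQ' QP QN.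
have aC' : acyclic_partition A #|parts C'| C' by case/andP: bC' => /n_acyclicW.
have eC' : e \in arcs C' := pivot_arc bC' rC' pQ' QP QN.
have EC : contract C' e = C.
  rewrite (contract_cell A_sym aC' eC' (raise_collapses bC rC pQ Qs)).
  exact/esym/(cell_of_ranks aC rC).
have kE : k.+1 = #|parts C'|.
  have := contract_acyclic_partition A_sym aC' eC' cC'; rewrite EC => /card_parts.
  rewrite (card_parts aC) => ->; apply: prednK; apply/card_gt0P; by exists Q.
exists C', e; split => //; first by rewrite kE.
  exact: pivot_not_lower bC' rC' pQ' QP QN.
by move=> f cf fe lf; have := lower_contract_sink bC' rC' pQ' QP QN cf fe lf; rewrite EC.
Qed.

(** The matching read from its lower cell to its upper cell; being functional, it shows that
    different upper cells have different partners. *)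
Definition raises E C :=
  exists2 Q, pivot A b (crank E) Q & C = cell A (raise_rank (crank E) Q).

Lemma raises_unique E C C' : raises E C -> raises E C' -> C = C'.
Proof. by case=> Q pQ -> [Q' pQ' ->]; rewrite (pivot_unique pQ pQ'). Qed.

Lemma upper_partner k C : max_cut A b != set0 -> bounded_cell k C -> ~~ lower C ->
  exists e, [/\ contractible C e, lower (contract C e), raises (contract C e) C &
    forall f, contractible C f -> f != e -> lower (contract C f) ->
      (#|sink (contract C f)| < #|sink (contract C e)|)%N].
Proof.
move=> m0 bC lC; have aC : acyclic_partition A k C by case/andP: bC => /n_acyclicW.
have [r rC] := ranks_exists aC; have [Q pQ] := pivot_exists A_sym r m0.
case: (pivot_dichotomy bC rC pQ) => [Qs|[QP QN]].
  by case/negP: lC; apply/(lowerP aC rC); exists Q.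
exists (Q, sink C); split.
- exact: pivot_contractible bC rC pQ QP QN.
- exact: contract_pivot_lower bC rC pQ QP QN.
- have aE : acyclic_partition A k.-1 (contract C (Q, sink C)).
    apply: (contract_acyclic_partition A_sym aC); first exact: (pivot_arc bC rC pQ QP QN).
    exact: pivot_contractible bC rC pQ QP QN.
  have rE := crank_ranks aE; exists Q; first exact: (contract_pivot bC rC pQ QP QN rE).
  exact: (expand_contract bC rC pQ QP QN rE).
- exact: lower_contract_sink bC rC pQ QP QN.
Qed.

Lemma bounded_contract k C e : bounded_cell k C -> contractible C e ->
  bounded_cell k.-1 (contract C e).
Proof.
case/andP=> nC Db ce; rewrite /bounded_cell (contract_n_acyclic A_sym nC ce) /=.
by apply: lepm_trans Db; case: (D_contract A_sym (n_acyclicW nC) ce).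
Qed.

End Partners.

(** * Exactness from an acyclic matching, and cancellation by involutions *)

Local Open Scope ring_scope.

(* The matching is acyclic because gradient paths decrease [mu]. *)
Lemma matching_exact (K : fieldType) (T : finType) (d : T -> T -> K)
    (X1 X2 lower : pred T) (mu : T -> nat) (m : T -> T -> Prop) (c : T -> K) :
  (forall C E, X2 C -> d C E != 0 -> X1 E) ->
  (forall C E, X2 C -> \sum_B d C B * d B E = 0) ->
  (forall C, X1 C -> lower C -> exists C', [/\ X2 C', d C' C != 0 &
     forall E, lower E -> d C' E != 0 -> E != C -> (mu E < mu C)%N]) ->
  (forall C, X1 C -> ~~ lower C -> exists C', [/\ lower C', d C C' != 0, m C' C &
     forall E, lower E -> d C E != 0 -> E != C' -> (mu E < mu C')%N]) ->
  (forall C C1 C2, m C C1 -> m C C2 -> C1 = C2) ->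
  (forall C, c C != 0 -> X1 C) -> (forall E, \sum_C c C * d C E = 0) ->
  exists2 g, forall C, g C != 0 -> X2 C & forall E, \sum_C g C * d C E = c E.
Proof.
move=> X21 dd hup hdown muniq cX cycle.
have /fin_all_exists[up upP] C : exists C', X1 C -> lower C ->
    [/\ X2 C', d C' C != 0 &
        forall E, lower E -> d C' E != 0 -> E != C -> (mu E < mu C)%N].
  have [XC|] := boolP (X1 C); last by exists C.
  have [lC|] := boolP (lower C); last by exists C.
  by have [C' H] := hup C XC lC; exists C'.
have /fin_all_exists[dn dnP] C : exists C', X1 C -> ~~ lower C ->
    [/\ lower C', d C C' != 0, m C' C &
        forall E, lower E -> d C E != 0 -> E != C' -> (mu E < mu C')%N].
  have [XC|] := boolP (X1 C); last by exists C.
  have [lC|lC] := boolP (lower C); first by exists C.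
  by have [C' H] := hdown C XC lC; exists C'.
(* First the equation is solved on lower cells only, where the matching makes it triangular for
   [mu]; the induction is on a strict bound [M] for [mu] on the lower support of [c]. *)
have [g gX gl] : exists2 g, forall C, g C != 0 -> X2 C &
    forall E, lower E -> \sum_C g C * d C E = c E.
  have [M cM] : exists M, forall C, lower C -> c C != 0 -> (mu C < M)%N.
    by exists (\max_(C : T) mu C).+1 => C _ _; rewrite ltnS leq_bigmax.
  elim: M => [|M IH] in c cX cM {cycle} *.
    exists (fun=> 0) => [C|E lE]; first by rewrite eqxx.
    rewrite big1 => [|C _]; last by rewrite mul0r.
    by apply/esym/eqP/negPn/negP => /(cM _ lE).
  (* [h] cancels the lower coefficients of largest [mu] through the upward partners; the new lower
     terms it introduces have smaller [mu]. *)
  pose top C := [&& lower C, c C != 0 & mu C == M].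
  pose h B := \sum_(C | top C && (up C == B)) c C / d (up C) C.
  have hE E : \sum_B h B * d B E = \sum_(C | top C) c C / d (up C) C * d (up C) E.
    rewrite [RHS](partition_big up predT) //=; apply: eq_bigr => B _.
    by rewrite /h mulr_suml; apply: eq_bigr => C /andP[_ /eqP->].
  have hX B : h B != 0 -> X2 B.
    move=> hB; have [C /andP[/and3P[lC cC _] /eqP<-]] : exists C, top C && (up C == B).
      apply/existsP; apply: contraNT hB; rewrite negb_exists => /forallP nh.
      by rewrite /h big_pred0 // => C; apply/negbTE/nh.
    by case: (upP C (cX _ cC) lC).
  have [||g gX gE] := IH (fun E => c E - \sum_B h B * d B E).
  - move=> E; have [->|/cX//] := eqVneq (c E) 0; rewrite sub0r oppr_eq0.
    move=> nz; have [B] : exists B, h B * d B E != 0.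
      apply/existsP; apply: contraNT nz; rewrite negb_exists => /forallP nh.
      by rewrite big1 // => B _; apply/eqP/negPn/nh.
    by rewrite mulf_eq0 negb_or => /andP[/hX XB]; apply: X21.
  - move=> E lE; rewrite hE; have [|] := boolP (top E).
      move=> tE; rewrite (bigD1 E) //= => nz; have [_ cE /eqP mE] := and3P tE.
      have [_ dE _] := upP E (cX _ cE) lE.
      move: nz; rewrite divfK // big1 ?addr0 ?subrr ?eqxx // => C /andP[tC CE].
      have [lC cC /eqP mC] := and3P tC; have [_ _ H] := upP C (cX _ cC) lC.
      apply/eqP; rewrite mulf_eq0; apply/orP; right; apply: contraT => nd.
      by have := H E lE nd; rewrite eq_sym CE mE mC ltnn => /(_ isT).
    move=> tE nz; have : (mu E <= M)%N.
      have [c0|cE] := eqVneq (c E) 0; last by rewrite -ltnS cM.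
      have [C tC dC] : exists2 C, top C & d (up C) E != 0.
        apply/exists_inP; apply: contraNT nz; rewrite negb_exists => /forallP nh.
        rewrite c0 sub0r oppr_eq0 big1 // => C tC; have := nh C.
        by rewrite tC negbK => /eqP->; rewrite mulr0.
      have [lC cC /eqP mC] := and3P tC; have [_ _ H] := upP C (cX _ cC) lC.
      have [EC|EC] := eqVneq E C; first by rewrite EC mC.
      by rewrite -mC ltnW // H.
    rewrite leq_eqVlt => /orP[/eqP mE|//].
    have c0 : c E = 0 by apply: contraNeq tE => cE; rewrite /top lE cE mE eqxx.
    case/eqP: nz; rewrite c0 sub0r big1 ?oppr0 // => C tC.
    have [lC cC /eqP mC] := and3P tC; have [_ _ H] := upP C (cX _ cC) lC.
    apply/eqP; rewrite mulf_eq0; apply/orP; right; apply: contraT => nd.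
    have EC : E != C by apply: contraTneq tC => <-.
    by have := H E lE nd EC; rewrite mE mC ltnn.
  exists (fun B => g B + h B) => [B|E lE].
    have [->|/gX//] := eqVneq (g B) 0; rewrite add0r; exact: hX.
  under eq_bigr do rewrite mulrDl.
  by rewrite big_split /= gE // subrK.
exists g => // E.
(* The remainder is a cycle supported on upper cells. At the support cell whose partner has the
   largest [mu], that partner receives a single nonzero contribution, so the remainder vanishes. *)
pose c' E := c E - \sum_C g C * d C E.
have c'X C : c' C != 0 -> X1 C.
  rewrite /c'; have [->|/cX//] := eqVneq (c C) 0; rewrite sub0r oppr_eq0 => nz.
  have [B] : exists B, g B * d B C != 0.
    apply/existsP; apply: contraNT nz; rewrite negb_exists => /forallP nh.
    by rewrite big1 // => B _; apply/eqP/negPn/nh.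
  by rewrite mulf_eq0 negb_or => /andP[/gX XB]; apply: X21.
have c'l C : c' C != 0 -> ~~ lower C.
  by apply: contraNN => lC; rewrite /c' gl // subrr.
have c'cycle E' : \sum_C c' C * d C E' = 0.
  under eq_bigr do rewrite mulrBl mulr_suml.
  rewrite sumrB cycle exchange_big /= big1 ?subr0 // => B _.
  have [g0|/gX XB] := eqVneq (g B) 0; first by rewrite big1 // => C _; rewrite g0 !mul0r.
  by under eq_bigr do rewrite -mulrA; rewrite -mulr_sumr dd ?mulr0.
suff c'0 : c' E = 0 by apply/eqP; rewrite eq_sym -subr_eq0; apply/eqP.
apply/eqP/negPn/negP => cE0.
have [C cC Cmax] := @arg_maxnP _ E (fun C => c' C != 0) (fun C => mu (dn C)) cE0.
have [ld dC mC _] := dnP C (c'X _ cC) (c'l _ cC).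
have := c'cycle (dn C); rewrite (bigD1 C) //= big1 ?addr0 => [/eqP|C1 C1C].
  by rewrite mulf_eq0 (negPf cC) (negPf dC).
apply/eqP; rewrite mulf_eq0; apply/negPn/negP; rewrite negb_or => /andP[cC1 dC1].
have [_ _ mC1 H] := dnP C1 (c'X _ cC1) (c'l _ cC1).
have ne : dn C != dn C1.
  by apply: contraNneq C1C => E1; rewrite E1 in mC; rewrite (muniq _ _ _ mC mC1).
by have := H _ ld dC1 ne; rewrite ltnNge => /negP[]; apply: Cmax.
Qed.

Lemma sum_involution0 (T : finType) (R : zmodType) (P : pred T) (F : T -> R) (phi : T -> T) :
  (forall p, P p -> P (phi p)) -> (forall p, P p -> phi (phi p) = p) ->
  (forall p, P p -> phi p != p) -> (forall p, P p -> F (phi p) = - F p) ->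
  \sum_(p | P p) F p = 0.
Proof.
(* [q] selects one point of each orbit, so that terms cancel in pairs without dividing by 2. *)
move=> PP inv nofix FN; pose q p := (enum_rank p < enum_rank (phi p))%N.
rewrite (bigID q) /= [X in _ + X](reindex_onto phi phi) => [|p /andP[Pp _]]; last exact: inv.
rewrite -[X in _ + X]opprK -sumrN; apply/eqP; rewrite subr_eq0; apply/eqP.
apply: eq_big => [p|p /andP[Pp _]]; last by rewrite FN // opprK.
apply/andP/andP => [[Pp qp]|[/andP[Pp' nq] /eqP pp]].
  by rewrite PP // inv // eqxx /q inv // -leqNgt ltnW.
have Pp : P p by rewrite -pp PP.
split=> //; move: nq; rewrite /q pp -leqNgt leq_eqVlt => /orP[|//].
move=> /eqP/val_inj/enum_rank_inj E; by have := nofix p Pp; rewrite -E eqxx.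
Qed.

(** * The scalar incidence matrix *)

Section Incidence.
Variables (K : fieldType) (n : nat) (A : 'M[nat]_n.+1).
Hypothesis A_sym : forall i j, A i j = A j i.
Variable sgn : sign_function n.
Hypothesis sgnP : valid_sign A sgn.
Implicit Types (C E : pgraph n) (e f g : part n * part n) (k : nat).

Definition incid C E : K :=
  \sum_(e | contractible C e && (contract C e == E)) (sgn C e)%:~R.

Lemma incid_neq0 C E : incid C E != 0 -> exists2 e, contractible C e & contract C e = E.
Proof.
move=> nz; have [e /andP[ce /eqP eE]] : exists e, contractible C e && (contract C e == E).
  apply/existsP; apply: contraNT nz; rewrite negb_exists => /forallP nh.
  by rewrite /incid big_pred0 // => e; apply/negbTE/nh.
by exists e.
Qed.

Lemma incid_unique k C e : n_acyclic A k C -> contractible C e ->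
  (forall f, contractible C f -> f != e -> contract C f != contract C e) ->
  incid C (contract C e) != 0.
Proof.
move=> nC ce uniq; rewrite /incid (bigD1 e) ?ce ?eqxx //= big1 => [|f].
  rewrite addr0; case: (sgnP.1 _ _ _ nC ce) => ->; rewrite ?rmorphN ?oppr_eq0 rmorph1;
    exact: oner_neq0.
by case/andP => /andP[cf fE] fe; have := uniq f cf fe; rewrite fE.
Qed.

(** Pairs of successive contractions from [C] to [E] are exchanged by the involution sending (e,
    f/e) to (f, e/f), which reverses the product of signs. *)
Lemma incid_incid k C E : n_acyclic A k C -> \sum_B incid C B * incid B E = 0.
Proof.
move=> nC; have aC := n_acyclicW nC.
transitivity (\sum_(p : (part n * part n) * (part n * part n) |
    [&& contractible C p.1, contractible (contract C p.1) p.2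
      & contract (contract C p.1) p.2 == E])
    (sgn C p.1 * sgn (contract C p.1) p.2)%:~R : K).
  transitivity (\sum_(e | contractible C e) (sgn C e)%:~R * incid (contract C e) E).
    rewrite [RHS](partition_big (contract C) predT) //=; apply: eq_bigr => B _.
    by rewrite mulr_suml; apply: eq_bigr => e /andP[_ /eqP->].
  rewrite (eq_bigr (fun e => \sum_(g | contractible (contract C e) g &&
     (contract (contract C e) g == E)) (sgn C e * sgn (contract C e) g)%:~R)).
    by rewrite pair_big_dep.
  by move=> e _; rewrite mulr_sumr; apply: eq_bigr => g _; rewrite intrM.
pose other (p : (part n * part n) * (part n * part n)) f :=
  [&& contractible C f, f != p.1 & induced_arc p.1 f == p.2].
pose phi p := odflt p (omap (fun f => (f, induced_arc f p.1)) [pick f | other p f]).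
have phiP e g : contractible C e -> contractible (contract C e) g ->
    exists f, [/\ phi (e, g) = (f, induced_arc f e), f != e, contractible C f,
      contractible (contract C f) (induced_arc f e) & induced_arc e f = g /\
      contract (contract C f) (induced_arc f e) = contract (contract C e) g].
  move=> ce cg; have [f [fe cf fg cf' E']] := contraction_diamond A_sym aC ce cg.
  exists f; split=> //; rewrite /phi; case: pickP => [h /and3P[/= ch he /eqP hg]|/(_ f)].
    congr (_, _); first (have eC : e \in arcs C by case/andP: ce);
      by rewrite /= (induced_arc_inj aC (proj1 (andP ce)) he fe ch cf) // hg.
  by rewrite /other cf fe fg eqxx.
apply: (sum_involution0 (phi := phi)) => -[e g] /and3P[/= ce cg /eqP gE];
  have [f [-> fe cf cf' [fg E']]] := phiP e g ce cg.
- by rewrite cf cf' E' gE eqxx.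
- have [h [-> hf ch ch' [hg _]]] := phiP _ _ cf cf'.
  have eC : f \in arcs C by case/andP: cf.
  have -> : h = e by apply: (induced_arc_inj aC eC hf _ ch ce hg); rewrite eq_sym.
  by rewrite fg.
- by apply/negP => /eqP[E0]; rewrite E0 eqxx in fe.
rewrite /= -rmorphN /= -fg; congr (_%:~R).
have ef : e <> f by apply/eqP; rewrite eq_sym.
by have := sgnP.2 k C e f nC ef ce cf; rewrite fg => /(_ cg cf')->; rewrite opprK.
Qed.

(** Here [k] counts parts, so k = 1 is homological degree zero; that case yields the cut monomials
    as boundaries. *)
Lemma strand_exact (b : 'X_{1..n.+1}) k (c : pgraph n -> K) :
  max_cut A b != set0 -> (forall C, c C != 0 -> bounded_cell A b k C) ->
  (forall E, \sum_C c C * incid C E = 0) ->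
  exists2 g, forall C, g C != 0 -> bounded_cell A b k.+1 C &
    forall E, \sum_C g C * incid C E = c E.
Proof.
move=> m0 cX cycle.
have uniq l C e : bounded_cell A b l C -> contractible C e -> lower A b (contract C e) ->
    (forall f, contractible C f -> f != e -> lower A b (contract C f) ->
       (#|sink (contract C f)| < #|sink (contract C e)|)%N) ->
    incid C (contract C e) != 0.
  case/andP=> nC _ ce le H; apply: incid_unique nC ce _ => f cf fe.
  by apply/eqP => E; have := H f cf fe; rewrite E ltnn => /(_ le).
have mono l C e : bounded_cell A b l C -> 
    (forall f, contractible C f -> f != e -> lower A b (contract C f) ->
       (#|sink (contract C f)| < #|sink (contract C e)|)%N) ->
    forall E, lower A b E -> incid C E != 0 -> E != contract C e ->
       (#|sink E| < #|sink (contract C e)|)%N.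
  move=> bC H E lE /incid_neq0[f cf fE] ne; subst E.
  by apply: H => //; apply: contraNneq ne => ->.
apply: (matching_exact (mu := fun C => #|sink C|) (m := raises A b) (lower := lower A b)
          (X1 := bounded_cell A b k)) => //.
- by move=> C E bC /incid_neq0[e ce <-]; apply: bounded_contract bC ce.
- by move=> C E /andP[nC _]; apply: incid_incid nC.
- move=> C bC lC; have [C' [e [bC' uC' ce eC H]]] := lower_partner A_sym bC lC.
  exists C'; subst C; split => //; first exact: uniq bC' ce lC H.
  exact: mono bC' H.
- move=> C bC uC; have [e [ce lE rE H]] := upper_partner A_sym m0 bC uC.
  exists (contract C e); split => //; first exact: uniq bC ce lE H.
  exact: mono bC H.
- by move=> C C1 C2; apply: raises_unique.
Qed.

End Incidence.

(** * Multigraded strands of the complex *)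

Section Strands.
Variables (K : fieldType) (n : nat) (A : 'M[nat]_n.+1).
Hypothesis A_sym : forall i j, A i j = A j i.
Local Notation R := {mpoly K[n.+1]}.
Implicit Types (C E : pgraph n) (e f g : part n * part n) (k : nat).
Implicit Types (b d : 'X_{1..n.+1}) (c : pgraph n -> K).

(** The component of [z] in multidegree [d], extended by zero to all [pgraph]s so that strands in
    different homological degrees share one finite index type. The test D(C) <= d guards the
    truncated subtraction. *)
Definition strand k d (z : F K A k) C : K :=
  if insub C is Some C' then
    if (D A C <= d)%MM then (z C' : R)@_(d - D A C) else 0
  else 0.

Lemma strand_val k d (z : F K A k) (C : basis_index A k) :
  strand d z (val C) =
  if (D A (val C) <= d)%MM then (z C : R)@_(d - D A (val C)) else 0.
Proof. by rewrite /strand valK. Qed.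

Lemma strand_out k d (z : F K A k) C : ~~ bounded_cell A d k.+1 C -> strand d z C = 0.
Proof.
rewrite /bounded_cell /strand; case: insubP => // C' nC EC; rewrite nC /=.
by move/negPf->.
Qed.

Lemma strand_bounded k d (z : F K A k) C : strand d z C != 0 -> bounded_cell A d k.+1 C.
Proof. by apply: contraNT => /strand_out->. Qed.

Lemma strand0 k d C : strand d (0 : F K A k) C = 0.
Proof. by rewrite /strand; case: insubP => // C' _ _; rewrite ffunE mcoeff0 if_same. Qed.

Lemma strandD k d (z z' : F K A k) C : strand d (z + z') C = strand d z C + strand d z' C.
Proof.
rewrite /strand; case: insubP => [C' _ _|_]; last by rewrite addr0.
by case: ifP => _; rewrite ?addr0 // ffunE mcoeffD.
Qed.

Lemma strand_sum k d (I : Type) (s : seq I) (P : pred I) (z : I -> F K A k) C :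
  strand d (\sum_(i <- s | P i) z i) C = \sum_(i <- s | P i) strand d (z i) C.
Proof.
exact: (big_morph (fun z => strand d z C) (fun z z' => strandD d z z' C) (strand0 k d C)).
Qed.

Lemma strand_inj k (z z' : F K A k) :
  (forall d C, strand d z C = strand d z' C) -> z = z'.
Proof.
move=> H; apply/ffunP => C; apply/mpolyP => m.
have := H (m + D A (val C))%MM (val C); rewrite !strand_val.
by rewrite lem_addl addmK.
Qed.

(** Inverse to [strand] in degree [d], for [c] supported on cells with D(C) <= d. *)
Definition homog_lift k d c : F K A k := [ffun C => c (val C) *: 'X_[d - D A (val C)]].

Lemma strand_lift k d d' c C : (forall C, c C != 0 -> bounded_cell A d k.+1 C) ->
  strand d' (homog_lift k d c) C = (d == d')%:R * c C.
Proof.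
move=> cX; have [/cX/andP[nC Dd]|] := boolP (c C != 0); last first.
  rewrite negbK => /eqP c0; rewrite c0 mulr0 /strand; case: insubP => // C' _ EC.
  by rewrite ffunE EC c0 scale0r mcoeff0 if_same.
have EC : C = val (Sub C nC : basis_index A k) by rewrite SubK.
rewrite EC strand_val ffunE -EC mcoeffZ mcoeffX mulrC.
have [<-|ne] := eqVneq d d'; first by rewrite Dd eqxx.
case: ifP => [Dd'|_]; last by rewrite mul0r.
suff -> : (d - D A C == d' - D A C)%MM = false by [].
by apply: contraNF ne => /eqP E; rewrite -(submK Dd) -(submK Dd') E.
Qed.

Lemma mcoeff_shift (p : R) (m0 m1 d : 'X_{1..n.+1}) : (m0 <= m1)%MM -> (m0 <= d)%MM ->
  (p * 'X_[m1 - m0])@_(d - m0) = if (m1 <= d)%MM then p@_(d - m1) else 0.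
Proof.
move=> /mnm_lepP l1 /mnm_lepP ld; case: ifP => [/mnm_lepP l|].
  have -> : (d - m0 = (m1 - m0) + (d - m1))%MM.
    apply/mnmP => i; rewrite mnmDE !mnmBE.
    by have := l1 i; have := ld i; have := l i; lia.
  by rewrite mcoeffMX.
move=> nl; apply/eqP; rewrite mcoeff_eq0 (perm_mem (msuppMX _ _)).
apply: contraFN nl => /mapP[m' _ /mnmP E]; apply/mnm_lepP => i.
by have := E i; have := l1 i; have := ld i; rewrite mnmDE !mnmBE; lia.
Qed.

Section Differential.
Variable sgn : sign_function n.
Hypothesis sgnP : valid_sign A sgn.

Lemma deltaE k (z : F K A k.+1) (E : basis_index A k) :
  delta sgn z E = \sum_(C : basis_index A k.+1) \sum_(e | contractible (val C) e &&
     (contract (val C) e == val E))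
    (sgn (val C) e)%:~R * ((z C : R) * arc_monomial K A (val C) e).
Proof.
rewrite /delta sum_ffunE; apply: eq_bigr => C _.
rewrite ffunE /delta_basis sum_ffunE /GRing.scale /= mulr_sumr.
rewrite [RHS]big_mkcondr /=; apply: eq_bigr => e _.
rewrite !ffunE /GRing.scale /= eq_sym; case: eqP => _; last by rewrite !mulr0.
by rewrite mulr1 mulrCA.
Qed.

(** Multiplying by x^(D(C) - D(E)) carries the coefficient at d - D(C) to the one at d - D(E), so
    only the signs remain. *)
Lemma strand_delta k d (z : F K A k.+1) E :
  strand d (delta sgn z) E = \sum_C strand d z C * incid K sgn C E.
Proof.
have [bE|bE] := boolP (bounded_cell A d k.+1 E); last first.
  rewrite strand_out // big1 // => C _; apply/eqP; rewrite mulf_eq0.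
  apply/negPn/negP; rewrite negb_or => /andP[/strand_bounded bC /incid_neq0[e ce eE]].
  by case/negP: bE; rewrite -eE; apply: (bounded_contract A_sym bC ce).
have /andP[nE Dd] := bE.
have EE : E = val (Sub E nE : basis_index A k) by rewrite SubK.
rewrite EE strand_val -EE Dd deltaE raddf_sum -EE /=.
rewrite [RHS](bigID (fun C => n_acyclic A k.+2 C)) /= [X in _ + X]big1 => [|C nC]; last first.
  by rewrite strand_out ?mul0r // /bounded_cell (negPf nC).
rewrite addr0 (reindex_omap (val : basis_index A k.+1 -> _) insub) => [|C nC]; last first.
  by rewrite insubT.
apply: eq_big => [C|C _]; first by rewrite (valP C) valK eqxx.
rewrite raddf_sum /incid mulr_sumr; apply: eq_bigr => e /andP[ce /eqP eE] /=.
rewrite mulrzl raddfMz /= strand_val -mulrzr; congr (_ * _).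
have [le _] := D_contract A_sym (n_acyclicW (valP C)) ce.
by rewrite eE in le; rewrite /arc_monomial eE; apply: mcoeff_shift.
Qed.

Lemma delta_lift k d c : (forall C, c C != 0 -> bounded_cell A d k.+2 C) ->
  delta sgn (homog_lift k.+1 d c) = homog_lift k d (fun E => \sum_C c C * incid K sgn C E).
Proof.
move=> cX; apply: strand_inj => d' E; rewrite strand_delta strand_lift.
  by rewrite mulr_sumr; apply: eq_bigr => C _; rewrite strand_lift // mulrA.
move=> E'; apply: contraNT => bE; rewrite big1 // => C _; apply/eqP.
rewrite mulf_eq0; apply/negPn/negP.
rewrite negb_or => /andP[/cX bC /incid_neq0[e ce eE]].
by case/negP: bE; rewrite -eE; apply: (bounded_contract A_sym bC ce).
Qed.

Lemma strand_decomposition k (z : F K A k) :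
  exists s : seq 'X_{1..n.+1}, z = \sum_(d <- s) homog_lift k d (strand d z).
Proof.
exists (undup (flatten
  [seq [seq (m + D A (val C))%MM | m <- msupp (z C : R)] | C : basis_index A k])).
set s := undup _; apply: strand_inj => d C; rewrite strand_sum.
under eq_bigr do rewrite (strand_lift _ _ (@strand_bounded _ _ z)).
have [ds|ds] := boolP (d \in s).
  rewrite (bigD1_seq d) ?undup_uniq //= eqxx mul1r big1 ?addr0 // => d' /negPf->.
  by rewrite mul0r.
rewrite [RHS]big1_seq => [|d' /= d's]; last first.
  by rewrite (_ : d' == d = false) ?mul0r //; apply: contraNF ds => /eqP<-.
apply: contraNeq ds; rewrite /strand; case: insubP => [C' _ EC|]; last by rewrite eqxx.
case: ifP => [Dd|]; last by rewrite eqxx.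
rewrite -mcoeff_msupp => md; rewrite mem_undup; apply/flattenP.
exists [seq (m + D A (val C'))%MM | m <- msupp (z C' : R)].
  by apply: image_f.
by apply/mapP; exists (d - D A C)%MM; rewrite // EC submK.
Qed.

Lemma delta_delta k (z : F K A k.+2) : delta sgn (delta sgn z) = 0.
Proof.
apply: strand_inj => d E; rewrite strand0 strand_delta.
under eq_bigr do rewrite strand_delta mulr_suml.
rewrite exchange_big big1 //= => C _.
have [->|/strand_bounded/andP[nC _]] := eqVneq (strand d z C) 0.
  by rewrite big1 // => B _; rewrite !mul0r.
under eq_bigr do rewrite -mulrA.
by rewrite -mulr_sumr (incid_incid K A_sym sgnP _ nC) mulr0.
Qed.

Lemma full_sink k C : n_acyclic A k C -> sink C = setT -> k = 1%N.
Proof.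
move=> nC sT; have aC := n_acyclicW nC; have hP := acyclic_part aC.
have inS x : x \in sink C by rewrite sT inE.
rewrite -(card_parts aC) -[RHS](cards1 (sink C)); congr #|pred_of_set _|.
apply/setP => U; rewrite inE; apply/idP/eqP => [|->]; last exact: block_in hP _.
case/(part_block hP) => x _ ->.
by rewrite (blockE hP (block_in hP ord_max) (inS x)).
Qed.

Lemma bounded_cell_no_cut b k C : max_cut A b = set0 -> bounded_cell A b k C -> k = 1%N.
Proof.
move=> m0 /andP[nC Db]; apply: (full_sink nC).
have := sub_max_cut (sink_bounded A_sym nC Db).
by rewrite m0 subset0 => /eqP s0; rewrite -[sink C]setCK s0 setC0.
Qed.

Lemma delta_exact k (f : F K A k.+1) :
  delta sgn f = 0 -> exists g : F K A k.+2, delta sgn g = f.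
Proof.
move=> f0; have [s fE] := strand_decomposition f; rewrite fE {fE}.
elim/big_ind: _.
- by exists 0; apply: linear0.
- by move=> _ _ [g1 <-] [g2 <-]; exists (g1 + g2); apply: linearD.
move=> d _; have [m0|m0] := eqVneq (max_cut A d) set0.
  exists 0; rewrite linear0; apply: strand_inj => d' C; rewrite strand0 strand_lift; last first.
    exact: strand_bounded.
  by rewrite [strand d f C]strand_out ?mulr0 //; apply/negP => /(bounded_cell_no_cut m0).
have cycle E : \sum_C strand d f C * incid K sgn C E = 0.
  by rewrite -strand_delta f0 strand0.
have [g gX gE] := strand_exact A_sym sgnP m0 (@strand_bounded _ d f) cycle.
exists (homog_lift k.+2 d g); rewrite delta_lift //; apply: strand_inj => d' C.
rewrite !strand_lift ?gE // => C'; last by rewrite gE; apply: strand_bounded.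
exact: strand_bounded.
Qed.

Lemma delta_injective k : k.+1 = n -> injective (@delta K n A sgn k).
Proof.
move=> kn f f' ff'; apply/eqP; rewrite -subr_eq0; apply/eqP.
have [|g <-] := @delta_exact k (f - f'); first by rewrite linearB /= ff' subrr.
(* The preimage lives on cells with n + 2 parts, but there are only n + 1 vertices. *)
suff -> : g = 0 by apply: linear0.
apply/ffunP => -[C nC]; exfalso.
have aC := n_acyclicW nC; have := card_parts aC; have hP := acyclic_part aC.
have : (#|parts C| <= #|[set: 'I_n.+1]|)%N.
  have -> : parts C = [set pblock (parts C) x | x in [set: 'I_n.+1]].
    apply/setP => U; apply/idP/imsetP => [/(part_block hP)[x _ ->]|[x _ ->]].
      by exists x; rewrite ?inE.
    exact: block_in.
  exact: leq_imset_card.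
by rewrite cardsT card_ord; move=> le E; move: le; rewrite E -kn ltnn.
Qed.

Lemma delta_homogeneous k d (f : F K A k.+1) :
  homogeneous d f -> homogeneous d (delta sgn f).
Proof.
move=> hf; have sf d' C : d' != d -> strand d' f C = 0.
  move=> ne; apply: contraNeq ne; rewrite /strand.
  case: insubP => [C' _ EC|]; last by rewrite eqxx.
  case: ifP => [Dd|]; last by rewrite eqxx.
  by rewrite -mcoeff_msupp => /hf; rewrite EC submK // => ->.
move=> C m mC; apply/eqP/negPn/negP => ne.
have := strand_delta (m + D A (val C)) f (val C).
rewrite strand_val lem_addl addmK big1 => [|B _]; last by rewrite sf ?mul0r.
by apply/eqP; rewrite -mcoeff_msupp.
Qed.

End Differential.
End Strands.

(** * Degree zero, the ideal M_G, and minimality *)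

Section Resolution.
Variables (K : fieldType) (n : nat) (A : 'M[nat]_n.+1).
Hypothesis A_sym : forall i j, A i j = A j i.
Hypothesis A_conn : connected_graph A.
Variable sgn : sign_function n.
Hypothesis sgnP : valid_sign A sgn.
Local Notation R := {mpoly K[n.+1]}.
Implicit Types (C E : pgraph n) (e f g : part n * part n) (k : nat).

Definition one_part : pgraph n := cell A (fun=> 0%N).

Lemma arc_one_part U W : arc one_part U W = false.
Proof. by apply/negP => /arc_cellP[x [y []]]. Qed.

Lemma lcomp_one_part x : lcomp A (fun=> 0%N) x = setT.
Proof.
apply/setP => y; rewrite !inE.
have := induced_connectedP _ _ A_conn x y (in_setT x) (in_setT y).
apply: connect_sub => s t /and3P[_ _ a].
by rewrite connect1 // levelE a eqxx.
Qed.

Lemma one_part_n_acyclic : n_acyclic A 1 one_part.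
Proof.
have -> : 1%N = #|parts one_part|.
  rewrite -(cards1 [set: 'I_n.+1]); congr #|pred_of_set _|; apply/setP => U.
  rewrite inE; apply/eqP/imsetP => [->|[x _ ->]]; last by rewrite lcomp_one_part.
  by exists ord_max; rewrite ?inE ?lcomp_one_part.
apply/n_acyclicP; split; first exact: cell_acyclic_partition.
by move=> x; rewrite (pblock_cell A_sym) lcomp_one_part inE.
Qed.

Lemma n_acyclic1 C : n_acyclic A 1 C -> C = one_part.
Proof.
move=> nC; have aC := n_acyclicW nC; have hP := acyclic_part aC.
have [r [r0 r1]] := ranks_exists aC.
have /eqP/cards1P[U EU] := card_parts aC.
have bU x : pblock (parts C) x = U by apply/set1P; rewrite -EU block_in.
apply: (cell_of_ranks aC); split=> // x y /r1.
by rewrite (r0 x y) ?ltnn // !bU.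
Qed.

Lemma D_one_part : D A one_part = 0%MM.
Proof.
apply/mnmP => u; rewrite mnmE mnm0E.
rewrite (outdegE A_sym u (n_acyclicW one_part_n_acyclic) (cell_ranks A_sym _)).
exact: big_pred0.
Qed.

Definition index0 : basis_index A 0 := Sub one_part one_part_n_acyclic.

Lemma index0_unique (C : basis_index A 0) : C = index0.
Proof. by apply/val_inj/n_acyclic1/(valP C). Qed.

Lemma F0_to_RE (f : F K A 0) : F0_to_R f = f index0.
Proof.
rewrite /F0_to_R (bigD1 index0) //= big1 ?addr0 // => C.
by rewrite (index0_unique C) eqxx.
Qed.

Lemma F0_to_RD (f g : F K A 0) : F0_to_R (f + g) = F0_to_R f + F0_to_R g.
Proof. by rewrite -big_split; apply: eq_bigr => C _; rewrite ffunE. Qed.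

Lemma F0_to_R_bij : bijective (@F0_to_R K n A).
Proof.
exists (fun p : R => [ffun=> p] : F K A 0) => [f|p]; last by rewrite F0_to_RE ffunE.
by apply/ffunP => C; rewrite ffunE F0_to_RE (index0_unique C).
Qed.

Lemma in_MG_sum (I : Type) (s : seq I) (P : pred I) (p : I -> R) :
  (forall i, P i -> in_MG A (p i)) -> in_MG A (\sum_(i <- s | P i) p i).
Proof.
move=> H; elim/big_ind: _ => // [|_ _ [c1 ->] [c2 ->]].
  by exists (fun=> 0); rewrite big1 // => S _; rewrite mul0r.
exists (fun S => c1 S + c2 S); rewrite -big_split /=.
by apply: eq_bigr => S _; rewrite mulrDl.
Qed.

Lemma in_MG_mul (a p : R) : in_MG A p -> in_MG A (a * p).
Proof.
case=> c ->; exists (fun S => a * c S); rewrite mulr_sumr.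
by apply: eq_bigr => S _; rewrite mulrA.
Qed.

Lemma cut_monomial_in_MG (S : {set 'I_n.+1}) :
  S != set0 -> ord_max \notin S -> in_MG A (cut_monomial K A S).
Proof.
move=> S0 nS; exists (fun T => (T == S)%:R).
rewrite (bigD1 S) ?S0 //= eqxx mul1r big1 ?addr0 // => T /andP[_ /negPf->].
by rewrite mul0r.
Qed.

Definition cut_degree (S : {set 'I_n.+1}) : 'X_{1..n.+1} :=
  [multinom if u \in S then \sum_(j in ~: S) A u j else 0 | u < n.+1]%N.

Lemma cut_monomialE S : cut_monomial K A S = 'X_[cut_degree S].
Proof.
rewrite mpolyXE_id /cut_monomial big_mkcond; apply: eq_bigr => u _.
by rewrite mnmE; case: ifP; rewrite ?expr0.
Qed.

Lemma bounded_cutE b (S : {set 'I_n.+1}) :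
  bounded_cut A b S = (ord_max \notin S) && (cut_degree S <= b)%MM.
Proof.
congr (_ && _); apply/forall_inP/mnm_lepP => H u; last first.
  by move=> uS; have := H u; rewrite mnmE uS.
by rewrite mnmE; case: ifP => // /H.
Qed.

(** In the degree of this monomial [S] is itself a bounded cut, so the strand is exact; the one-part
    cell has no arcs, hence is a cycle and therefore a boundary. *)
Lemma cut_monomial_boundary (S : {set 'I_n.+1}) : S != set0 -> ord_max \notin S ->
  exists g : F K A 1, F0_to_R (delta sgn g) = cut_monomial K A S.
Proof.
move=> S0 nS; set b := cut_degree S.
have m0 : max_cut A b != set0.
  apply: contraNneq S0 => m0; rewrite -subset0 -m0; apply: sub_max_cut.
  by rewrite bounded_cutE nS lepm_refl.
pose c C : K := (C == one_part)%:R.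
have cX C : c C != 0 -> bounded_cell A b 1 C.
  rewrite /c; have [-> _|_] := eqVneq C one_part; last by rewrite eqxx.
  rewrite /bounded_cell one_part_n_acyclic D_one_part.
  by apply/mnm_lepP => i; rewrite mnm0E.
have cycle E : \sum_C c C * incid K sgn C E = 0.
  rewrite (bigD1 one_part) //= [X in _ + X]big1 => [|C /negPf]; last first.
    by rewrite /c => ->; rewrite mul0r.
  rewrite addr0 /c eqxx mul1r; apply/eqP/negPn/negP => /incid_neq0[[U W] /andP[eC _] _].
  by have := arc_one_part U W; rewrite /Defs.arc eC.
have [g gX gE] := strand_exact A_sym sgnP m0 cX cycle.
exists (homog_lift A 1 b g); rewrite delta_lift // F0_to_RE ffunE gE.
by rewrite /c eqxx scale1r D_one_part subm0 cut_monomialE.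
Qed.

(** C/e is the one-part cell of degree 0, so the monomial is x^D(C), and [sink_bounded] with b =
    D(C) shows that the cut monomial of the complement of the sink divides it. *)
Lemma arc_monomial_in_MG C e : n_acyclic A 2 C -> contractible C e ->
  in_MG A (arc_monomial K A C e).
Proof.
move=> nC ce; have nE := contract_n_acyclic A_sym nC ce.
rewrite /arc_monomial (n_acyclic1 nE) D_one_part subm0.
have := sink_bounded A_sym nC (lepm_refl _).
rewrite bounded_cutE => /andP[nS le].
rewrite -(submK le) mpolyXD -cut_monomialE; apply/in_MG_mul/cut_monomial_in_MG => //.
by apply/eqP => s0; have := full_sink nC; rewrite -[sink C]setCK s0 setC0 => /(_ erefl).
Qed.

Lemma in_MGP (p : R) : in_MG A p <-> exists g : F K A 1, F0_to_R (delta sgn g) = p.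
Proof.
split=> [[c ->]|[g <-]].
  elim/big_ind: _ => [|_ _ [g1 <-] [g2 <-]|S /andP[S0 nS]].
  - by exists 0; rewrite linear0 F0_to_RE ffunE.
  - by exists (g1 + g2); rewrite linearD F0_to_RD.
  have [g gE] := cut_monomial_boundary S0 nS.
  by exists (c S *: g); rewrite linearZ /= -gE !F0_to_RE ffunE.
rewrite F0_to_RE deltaE; apply: in_MG_sum => C _; apply: in_MG_sum => e /andP[ce _].
by apply/in_MG_mul/in_MG_mul/arc_monomial_in_MG; first exact: (valP C).
Qed.

Lemma in_mF_sum k (I : Type) (s : seq I) (P : pred I) (v : I -> F K A k) :
  (forall i, P i -> in_mF (v i)) -> in_mF (\sum_(i <- s | P i) v i).
Proof.
move=> H; elim/big_ind: _ => // [|_ _ [g1 ->] [g2 ->]].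
  by exists (fun=> 0); rewrite big1 // => i _; rewrite scaler0.
exists (fun i => g1 i + g2 i); rewrite -big_split /=.
by apply: eq_bigr => i _; rewrite scalerDr.
Qed.

Lemma in_mF_scale k (a : R) (v : F K A k) : in_mF v -> in_mF (a *: v).
Proof.
case=> g ->; exists (fun i => a *: g i); rewrite scaler_sumr.
by apply: eq_bigr => i _; rewrite !scalerA mulrC.
Qed.

Lemma in_mF_X k i (v : F K A k) : in_mF (('X_i : R) *: v).
Proof.
exists (fun j => if j == i then v else 0).
rewrite (bigD1 i) //= eqxx big1 ?addr0 // => j /negPf->.
by rewrite scaler0.
Qed.

(** By [D_contract] each arc monomial is divisible by the variable of a vertex whose outdegree
    drops. *)
Lemma delta_minimal k (f : F K A k.+1) : in_mF (delta sgn f).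
Proof.
apply: in_mF_sum => C _; apply/in_mF_scale/in_mF_sum => e ce.
have [_ [u lu]] := D_contract A_sym (n_acyclicW (valP C)) ce.
rewrite -scalerA; apply: in_mF_scale; rewrite /arc_monomial.
have le : (U_(u) <= D A (val C) - D A (contract (val C) e))%MM.
  by rewrite lep1mP mnmBE subn_eq0 -ltnNge.
rewrite -(submK le) mpolyXD -scalerA; apply: in_mF_scale; exact: in_mF_X.
Qed.

End Resolution.
Theorem theorem4p1 (K : fieldType) (n : nat) (A : 'M[nat]_n.+1)
    (A_sym : forall i j, A i j = A j i) (A_conn : connected_graph A)
    (sgn : sign_function n) (sgnP : valid_sign A sgn) :
  [/\ (* the differentials are multigraded and compose to zero *)
      forall k d (f : F K A k.+1), (k < n)%N ->
        homogeneous d f -> homogeneous d (delta sgn f),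
      forall k (f : F K A k.+2), (k.+1 < n)%N -> delta sgn (delta sgn f) = 0,
      (* exactness in positive homological degrees *)
      (forall k (f : F K A k.+1), (k.+1 < n)%N -> delta sgn f = 0 ->
        exists g : F K A k.+2, delta sgn g = f) /\
      (forall k, k.+1 = n -> injective (@delta K n A sgn k)),
      (* F_0 = R, and the image of F_1 in it is M_G *)
      bijective (@F0_to_R K n A) /\
      (forall p : {mpoly K[n.+1]},
         in_MG A p <-> exists g : F K A 1, F0_to_R (delta sgn g) = p)
    & (* minimality *)
      forall k (f : F K A k.+1), (k < n)%N -> in_mF (delta sgn f)].
Proof.
split.
- by move=> k d f _; apply: delta_homogeneous.
- by move=> k f _; apply: delta_delta.
- split=> [k f _|k]; first exact: delta_exact.
  exact: delta_injective.
- split; first exact: F0_to_R_bij.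
  exact: in_MGP.
by move=> k f _; apply: delta_minimal.
Qed.
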